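(* Let $k$ be a field. (a) The full subcategory $\mathsf{Top}^{\mathsf{sc}}_{\mathbb Z}\simeq\mathsf{Pro}_{\mathsf{le}}(\mathsf{Ab})\subset\mathsf{Pro}(\mathsf{Ab})$ does not inherit an exact category structure from the abelian exact structure of the abelian category $\mathsf{Pro}(\mathsf{Ab})$. In fact, a short sequence in $\mathsf{Top}^{\mathsf{sc}}_{\mathbb Z}$ is exact in $\mathsf{Pro}(\mathsf{Ab})$ if and only if it satisfies Ex1 in $\mathsf{Top}^{\mathsf{sc}}_{\mathbb Z}$ (but the class of all short sequences satisfying Ex1 is not an exact category structure on $\mathsf{Top}^{\mathsf{sc}}_{\mathbb Z}$). In particular, the full subcategory $\mathsf{Pro}_{\mathsf{le}}(\mathsf{Ab})$ is not closed under extensions in $\mathsf{Pro}(\mathsf{Ab})$. (b) The full subcategory $\mathsf{Top}^{\mathsf{sc}}_k\simeq\mathsf{Pro}_{\mathsf{le}}(\mathsf{Vect}_k)\subset\mathsf{Pro}(\mathsf{Vect}_k)$ does not inherit an exact category structure from the abelian exact structure of the abelian category $\mathsf{Pro}(\mathsf{Vect}_k)$. In fact, a short sequence in $\mathsf{Top}^{\mathsf{sc}}_k$ is exact in $\mathsf{Pro}(\mathsf{Vect}_k)$ if and only if it satisfies Ex1 in $\mathsf{Top}^{\mathsf{sc}}_k$ (but the class of all short sequences satisfying Ex1 is not an exact category structure on $\mathsf{Top}^{\mathsf{sc}}_k$). In particular, the full subcategory $\mathsf{Pro}_{\mathsf{le}}(\mathsf{Vect}_k)$ is not closed under extensions in 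$\mathsf{Pro}(\mathsf{Vect}_k)$.
   Context: All topological abelian groups have linear topology: open subgroups form a base of neighborhoods of zero. All topological $k$-vector spaces ($k$ a fixed field with the discrete topology) have linear topology: open vector subspaces form a base of neighborhoods of zero. The completion of $A$ is $A^{\wedge}=\varprojlim_{U\subset A}A/U$ over the open subgroups (resp. subspaces) $U$, topologized so that the kernels of the projections $A^{\wedge}\to A/U$ form a base of neighborhoods of zero. $A$ is separated (resp. complete) if $A\to A^{\wedge}$ is injective (resp. surjective). $\mathsf{Top}^{\mathsf{sc}}_{\mathbb Z}$ (resp. $\mathsf{Top}^{\mathsf{sc}}_k$) is the category of complete, separated topological abelian groups (resp. $k$-vector spaces) and continuous homomorphisms (resp. continuous $k$-linear maps); these are additive categories with kernels and cokernels. $\mathsf{Ab}$ and $\mathsf{Vect}_k$ are the categories of abelian groups and of $k$-vector spaces. For a category $\mathsf C$, $\mathsf{Pro}(\mathsf C)$ is the category of pro-objects: objects are projective systems $(P_\gamma)_{\gamma\in\Gamma}$ in $\mathsf C$ indexed by directed posets, denoted ''$\varprojlim$''$_{\gamma}P_\gamma$, with $\operatorname{Hom}(\text{''}\varprojlim\text{''}_\gamma P_\gamma,\text{''}\varprojlim\text{''}_\delta Q_\delta)=\varprojlim_\delta\varinjlim_\gamma\operatorname{Hom}_{\mathsf C}(P_\gamma,Q_\delta)$. If $\mathsf C$ is abelian, so is $\mathsf{Pro}(\mathsf C)$; $\mathsf C$ is a full subcategory of $\mathsf{Pro}(\mathsf C)$ (singleton systems). For a complete abelian category $\mathsf C$,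 the functor $\varprojlim\colon\mathsf{Pro}(\mathsf C)\to\mathsf C$, $\text{''}\varprojlim\text{''}_\gamma P_\gamma\mapsto\varprojlim_\gamma P_\gamma$, is right adjoint to the inclusion $\mathsf C\to\mathsf{Pro}(\mathsf C)$. A pro-object $P$ is limit-epimorphic if the adjunction morphism $\varprojlim P\to P$ is an epimorphism in $\mathsf{Pro}(\mathsf C)$; $\mathsf{Pro}_{\mathsf{le}}(\mathsf C)\subset\mathsf{Pro}(\mathsf C)$ is the full subcategory of such objects. The equivalences $\mathsf{Top}^{\mathsf{sc}}_{\mathbb Z}\simeq\mathsf{Pro}_{\mathsf{le}}(\mathsf{Ab})$ and $\mathsf{Top}^{\mathsf{sc}}_k\simeq\mathsf{Pro}_{\mathsf{le}}(\mathsf{Vect}_k)$ take a topological group (space) $\mathfrak V$ to $\text{''}\varprojlim\text{''}_{\mathfrak U\subset\mathfrak V}\mathfrak V/\mathfrak U$, with $\mathfrak U$ ranging over the open subgroups (subspaces); the inverse takes $P=\text{''}\varprojlim\text{''}_\gamma P_\gamma$ to $\varprojlim_\gamma P_\gamma$ with the topology of projective limit of discrete $P_\gamma$. A short sequence $0\to A'\overset{i}\to A\overset{p}\to A''\to0$ in an additive category satisfies Ex1 if $i$ is a kernel of $p$ and $p$ is a cokernel of $i$. ''Exact category structure'' is in the sense of Quillen. A full additive subcategory $\mathsf G$ of an exact category $\mathsf E$ inherits an exact category structure if the class of all short sequences in $\mathsf G$ that are exact in $\mathsf E$ is an exact category structure on $\mathsf G$. $\mathsf G$ is closed under extensions if for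 any short exact sequence $0\to E'\to E\to E''\to0$ in $\mathsf E$ with $E',E''\in\mathsf G$ one has $E\in\mathsf G$. *)

(* Defs.v *)
From HB Require Import structures.
From Corelib Require Import RelationClasses.
From Corelib Require Morphisms Setoid.
From mathcomp Require Import all_boot all_algebra ring_quotient.
From mathcomp Require Import boolp classical_sets topology tvs.

Set Implicit Arguments.
Unset Strict Implicit.
Unset Printing Implicit Defensive.

Import GRing.Theory.
Import Quotient.Exports.

Local Open Scope quotient_scope.
Local Open Scope classical_set_scope.
Local Open Scope ring_scope.

Declare Scope cat_scope.
Delimit Scope cat_scope with cat.
Local Open Scope cat_scope.

(* Equality of morphisms is an equivalence relation on each type [mor A B];
   this lets the sets [colim Hom] in pro-categories be represented by germs
   without forming quotient types. *)
Record category := Category {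
  obj :> Type;
  mor : obj -> obj -> Type;
  heq : forall A B, mor A B -> mor A B -> Prop;
  idmor : forall A, mor A A;
  mcomp : forall A B C, mor B C -> mor A B -> mor A C;
  heq_equiv : forall A B, Equivalence (@heq A B);
  mcomp_heq : forall A B C (g g' : mor B C) (f f' : mor A B),
    heq g g' -> heq f f' -> heq (mcomp g f) (mcomp g' f');
  mcompA : forall A B C D (h : mor C D) (g : mor B C) (f : mor A B),
    heq (mcomp h (mcomp g f)) (mcomp (mcomp h g) f);
  mcomp1m : forall A B (f : mor A B), heq (mcomp (idmor B) f) f;
  mcompm1 : forall A B (f : mor A B), heq (mcomp f (idmor A)) f
}.

Arguments idmor {c} A.
Arguments mcomp {c A B C} g f.
Arguments heq {c A B} f g.

Notation "g \om f" := (mcomp g f)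
  (at level 40, left associativity) : cat_scope.
Notation "f =m g" := (heq f g) (at level 70, no associativity) : cat_scope.

#[export] Instance heq_Equivalence (C : category) (A B : C) :
  Equivalence (@heq C A B) := heq_equiv A B.

Lemma heq_refl (C : category) (A B : C) (f : mor A B) : f =m f.
Proof. exact: Equivalence_Reflexive. Qed.

#[export] Hint Resolve heq_refl : core.

#[export] Instance comp_Proper (C : category) (X Y Z : C) :
  Morphisms.Proper
    (Morphisms.respectful (@heq C Y Z)
      (Morphisms.respectful (@heq C X Y) (@heq C X Z)))
    (@mcomp C X Y Z).
Proof. by move=> g g' gg' f f' ff'; apply: mcomp_heq. Qed.

Record functor (C D : category) := Functor {
  func_obj :> C -> D;
  func_mor : forall A B : C, mor A B -> mor (func_obj A) (func_obj B);
  func_mor_heq : forall (A B : C) (f g : mor A B), f =m g -> func_mor f =m func_mor g;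
  func_mor1 : forall A : C, func_mor (idmor A) =m idmor (func_obj A);
  func_morM : forall (X Y Z : C) (g : mor Y Z) (f : mor X Y),
    func_mor (g \om f) =m func_mor g \om func_mor f
}.

Definition full_subcat (C : category) (P : C -> Prop) : category :=
  @Category {A : C | P A}
    (fun A B => mor (sval A) (sval B))
    (fun A B => @heq C (sval A) (sval B))
    (fun A => idmor (sval A))
    (fun _ _ _ g f => g \om f)
    (fun A B => heq_equiv (sval A) (sval B))
    (fun _ _ _ => @mcomp_heq C _ _ _)
    (fun _ _ _ _ => @mcompA C _ _ _ _)
    (fun _ _ => @mcomp1m C _ _)
    (fun _ _ => @mcompm1 C _ _).

Lemma incl_heq (C : category) (P : C -> Prop) (A B : full_subcat P)
  (f g : mor A B) : f =m g -> @heq C (sval A) (sval B) f g.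
Proof. by []. Qed.

Definition incl (C : category) (P : C -> Prop) : functor (full_subcat P) C :=
  @Functor (full_subcat P) C (fun A => sval A) (fun _ _ f => f)
    (@incl_heq C P)
    (fun A => heq_refl (idmor (sval A)))
    (fun _ _ _ g f => heq_refl (@mcomp C _ _ _ g f)).

Section CategoryTheory.
Variable C : category.

Definition mono (A B : C) (f : mor A B) :=
  forall (X : C) (g h : mor X A), f \om g =m f \om h -> g =m h.

Definition epi (A B : C) (f : mor A B) :=
  forall (X : C) (g h : mor B X), g \om f =m h \om f -> g =m h.

Definition is_iso (A B : C) (f : mor A B) :=
  exists g : mor B A, g \om f =m idmor A /\ f \om g =m idmor B.

Definition zero_obj (Z : C) :=
  forall A : C,
    (exists u : mor A Z, forall v, v =m u) /\
    (exists u : mor Z A, forall v, v =m u).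

(* In an additive category, the zero morphisms are exactly those which factor
   through a zero object. *)
Definition zero_mor (A B : C) (f : mor A B) :=
  exists (Z : C) (u : mor A Z) (v : mor Z B), zero_obj Z /\ f =m v \om u.

Definition is_kernel (A B D : C) (i : mor A B) (p : mor B D) :=
  zero_mor (p \om i) /\
  forall (X : C) (g : mor X B), zero_mor (p \om g) ->
    exists u : mor X A, i \om u =m g /\ forall v, i \om v =m g -> v =m u.

Definition is_cokernel (A B D : C) (i : mor A B) (p : mor B D) :=
  zero_mor (p \om i) /\
  forall (X : C) (g : mor B X), zero_mor (g \om i) ->
    exists u : mor D X, u \om p =m g /\ forall v, v \om p =m g -> v =m u.

(* For f : A -> B and g : A -> D, with f' : D -> E and g' : B -> E. *)
Definition is_pushout (A B D E : C) (f : mor A B) (g : mor A D)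
    (f' : mor D E) (g' : mor B E) :=
  g' \om f =m f' \om g /\
  forall (X : C) (x : mor B X) (y : mor D X), x \om f =m y \om g ->
    exists u : mor E X, (u \om g' =m x /\ u \om f' =m y) /\
      forall v, v \om g' =m x -> v \om f' =m y -> v =m u.

(* For f : B -> A and g : D -> A, with f' : E -> D and g' : E -> B. *)
Definition is_pullback (A B D E : C) (f : mor B A) (g : mor D A)
    (f' : mor E D) (g' : mor E B) :=
  f \om g' =m g \om f' /\
  forall (X : C) (x : mor X B) (y : mor X D), f \om x =m g \om y ->
    exists u : mor X E, (g' \om u =m x /\ f' \om u =m y) /\
      forall v, g' \om v =m x -> f' \om v =m y -> v =m u.

(* A class of short sequences 0 -> A' -> A -> A'' -> 0. *)
Definition seq_class :=
  forall A' A A'' : C, mor A' A -> mor A A'' -> Prop.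

Definition Ex1 : seq_class :=
  fun A' A A'' i p => is_kernel i p /\ is_cokernel i p.

Definition adm_mono (E : seq_class) (A' A : C) (i : mor A' A) :=
  exists (A'' : C) (p : mor A A''), E _ _ _ i p.

Definition adm_epi (E : seq_class) (A A'' : C) (p : mor A A'') :=
  exists (A' : C) (i : mor A' A), E _ _ _ i p.

(* Quillen's axioms, in the equivalent form due to Keller, in which the
   "obscure axiom" is omitted because it follows from the other ones. *)
Record exact_structure (E : seq_class) : Prop := ExactStructure {
  exact_zero : exists Z : C, zero_obj Z /\ E _ _ _ (idmor Z) (idmor Z);
  exact_isom : forall (A' A A'' B' B B'' : C)
    (i : mor A' A) (p : mor A A'') (j : mor B' B) (q : mor B B'')
    (a' : mor A' B') (a : mor A B) (a'' : mor A'' B''),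
    is_iso a' -> is_iso a -> is_iso a'' ->
    a \om i =m j \om a' -> a'' \om p =m q \om a ->
    E _ _ _ i p -> E _ _ _ j q;
  exact_ker_coker : forall (A' A A'' : C) (i : mor A' A) (p : mor A A''),
    E _ _ _ i p -> Ex1 i p;
  exact_pushout : forall (A' A B' : C) (i : mor A' A) (f : mor A' B'),
    adm_mono E i ->
    exists (B : C) (j : mor B' B) (g : mor A B),
      is_pushout i f j g /\ adm_mono E j;
  exact_pullback : forall (A A'' B'' : C) (p : mor A A'') (f : mor B'' A''),
    adm_epi E p ->
    exists (B : C) (q : mor B B'') (g : mor B A),
      is_pullback p f q g /\ adm_epi E q;
  exact_comp_mono : forall (X Y Z : C) (i : mor X Y) (j : mor Y Z),
    adm_mono E i -> adm_mono E j -> adm_mono E (j \om i);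
  exact_comp_epi : forall (X Y Z : C) (p : mor X Y) (q : mor Y Z),
    adm_epi E p -> adm_epi E q -> adm_epi E (q \om p)
}.

(* The abelian exact structure (when C is abelian): 0 -> A' -> A -> A'' -> 0 is
   exact when A' -> A is a kernel of A -> A'' and A -> A'' a cokernel of
   A' -> A. *)
Definition abelian_exact : seq_class := Ex1.

Definition closed_under_extensions (E : seq_class) (P : C -> Prop) :=
  forall (A' A A'' : C) (i : mor A' A) (p : mor A A''),
    E _ _ _ i p -> P A' -> P A'' -> P A.

End CategoryTheory.

(* Used for a fully faithful F, which identifies G with a full subcategory. *)
Definition inherits_exact (G D : category) (F : functor G D)
    (E : seq_class D) :=
  exact_structure (C := G)
    (fun A' A A'' i p => E _ _ _ (func_mor F i) (func_mor F p)).

Record dirposet := DirPoset {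
  dp_car :> Type;
  dle : dp_car -> dp_car -> Prop;
  dle_refl : forall a, dle a a;
  dle_trans : forall a b c, dle a b -> dle b c -> dle a c;
  dle_anti : forall a b, dle a b -> dle b a -> a = b;
  dp_nonempty : exists a : dp_car, True;
  dp_directed : forall a b, exists c, dle a c /\ dle b c
}.

Section Pro.
Variable C : category.

Record proobj := ProObj {
  pidx : dirposet;
  pterm :> pidx -> C;
  ptr : forall a b : pidx, dle a b -> mor (pterm b) (pterm a);
  ptr1 : forall (a : pidx) (h : dle a a), ptr h =m idmor (pterm a);
  ptrM : forall (a b c : pidx) (hab : dle a b) (hbc : dle b c) (hac : dle a c),
    ptr hab \om ptr hbc =m ptr hac
}.

(* [germ P X] modulo [germ_eq] is colim_c Hom(P_c, X). *)
Definition germ (P : proobj) (X : C) := {c : pidx P & mor (P c) X}.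

Definition germ_eq (P : proobj) (X : C) (u v : germ P X) :=
  exists (c : pidx P) (hu : dle (projT1 u) c) (hv : dle (projT1 v) c),
    projT2 u \om ptr hu =m projT2 v \om ptr hv.

Definition germ_post (P : proobj) (X Y : C) (f : mor X Y) (u : germ P X) :
  germ P Y := existT _ (projT1 u) (f \om projT2 u).

(* Modulo [prohom_eq], [prohom P Q] is lim_d colim_c Hom(P_c, Q_d): an element
   of the limit is a compatible family of germs. *)
Definition prohom (P Q : proobj) :=
  {f : forall d : pidx Q, germ P (Q d) |
    forall (d e : pidx Q) (h : dle d e),
      germ_eq (germ_post (ptr h) (f e)) (f d)}.

Definition prohom_eq (P Q : proobj) (f g : prohom P Q) :=
  forall d, germ_eq (sval f d) (sval g d).

Lemma germ_eq_refl P X (u : germ P X) : germ_eq u u.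
Proof.
exists (projT1 u); exists (dle_refl _); exists (dle_refl _).
exact: heq_refl.
Qed.

Lemma germ_eq_sym P X (u v : germ P X) : germ_eq u v -> germ_eq v u.
Proof. by move=> [c [hu [hv e]]]; exists c, hv, hu; symmetry. Qed.

Lemma germ_eq_trans P X (u v w : germ P X) :
  germ_eq u v -> germ_eq v w -> germ_eq u w.
Proof.
move=> [c [hu [hv e]]] [c' [hv' [hw e']]].
have [d [hd hd']] := dp_directed c c'.
exists d, (dle_trans hu hd), (dle_trans hw hd').
rewrite -(ptrM hu hd) -(ptrM hw hd') !mcompA e -e' -!mcompA.
by rewrite (ptrM hv hd (dle_trans hv hd)) (ptrM hv' hd' (dle_trans hv hd)).
Qed.

Lemma prohom_eq_equiv P Q : Equivalence (@prohom_eq P Q).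
Proof.
split.
- by move=> f d; apply: germ_eq_refl.
- by move=> f g e d; apply: germ_eq_sym.
- by move=> f g h e e' d; apply: germ_eq_trans (e d) (e' d).
Qed.

Lemma germ_post_eq P X Y (f g : mor X Y) (u v : germ P X) :
  f =m g -> germ_eq u v -> germ_eq (germ_post f u) (germ_post g v).
Proof.
move=> fg [c [hu [hv e]]]; exists c, hu, hv => /=.
by rewrite -!mcompA e fg.
Qed.

Lemma germ_post_comp P X Y Z (f : mor X Y) (g : mor Y Z) (u : germ P X) :
  germ_eq (germ_post g (germ_post f u)) (germ_post (g \om f) u).
Proof.
by exists (projT1 u); exists (dle_refl _); exists (dle_refl _); rewrite /= mcompA.
Qed.

Lemma germ_post_id P X (u : germ P X) : germ_eq (germ_post (idmor X) u) u.
Proof.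
by exists (projT1 u); exists (dle_refl _); exists (dle_refl _); rewrite /= mcomp1m.
Qed.

(* Composition of a germ Q_c -> X with a pro-morphism P -> Q. *)
Definition germ_pull (P Q : proobj) (X : C) (u : germ Q X) (f : prohom P Q) :
  germ P X := germ_post (projT2 u) (sval f (projT1 u)).

Lemma germ_pull_eq P Q X (u v : germ Q X) (f g : prohom P Q) :
  germ_eq u v -> prohom_eq f g -> germ_eq (germ_pull u f) (germ_pull v g).
Proof.
move=> [c [hu [hv e]]] fg.
have hf := svalP f _ _ hu; have hg := svalP g _ _ hv.
apply: (germ_eq_trans (germ_post_eq (heq_refl _) (germ_eq_sym hf))).
apply: (germ_eq_trans (germ_post_comp _ _ _)).
apply: germ_eq_trans (germ_post_eq e (fg c)) _.
apply: (germ_eq_trans (germ_eq_sym (germ_post_comp _ _ _))).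
exact: germ_post_eq (heq_refl _) hg.
Qed.

Lemma prohom_refl P Q (f : prohom P Q) : prohom_eq f f.
Proof. by move=> d; apply: germ_eq_refl. Qed.

Lemma germ_pull_post P Q X Y (h : mor X Y) (u : germ Q X) (f : prohom P Q) :
  germ_eq (germ_pull (germ_post h u) f) (germ_post h (germ_pull u f)).
Proof. by apply: germ_eq_sym; apply: germ_post_comp. Qed.

Lemma procomp_subproof P Q R (g : prohom Q R) (f : prohom P Q)
  (d e : pidx R) (h : dle d e) :
  germ_eq (germ_post (ptr h) (germ_pull (sval g e) f))
          (germ_pull (sval g d) f).
Proof.
apply: germ_eq_trans (germ_eq_sym (germ_pull_post _ _ _)) _.
by apply: germ_pull_eq (svalP g d e h) (prohom_refl f).
Qed.

Definition procomp (P Q R : proobj) (g : prohom Q R) (f : prohom P Q) :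
  prohom P R :=
  exist _ (fun d => germ_pull (sval g d) f) (procomp_subproof g f).

Lemma proid_subproof P (d e : pidx P) (h : dle d e) :
  germ_eq (germ_post (ptr h) (existT _ e (idmor (P e)) : germ P (P e)))
          (existT _ d (idmor (P d)) : germ P (P d)).
Proof.
exists e, (dle_refl e), h => /=.
by rewrite mcomp1m ptr1 !mcompm1.
Qed.

Definition proid (P : proobj) : prohom P P :=
  exist _ (fun d => existT _ d (idmor (P d))) (@proid_subproof P).

Lemma procomp_eq P Q R (g g' : prohom Q R) (f f' : prohom P Q) :
  prohom_eq g g' -> prohom_eq f f' ->
  prohom_eq (procomp g f) (procomp g' f').
Proof. by move=> gg' ff' d; apply: germ_pull_eq. Qed.

Lemma procompA P Q R S (h : prohom R S) (g : prohom Q R) (f : prohom P Q) :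
  prohom_eq (procomp h (procomp g f)) (procomp (procomp h g) f).
Proof. by move=> d; apply: germ_post_comp. Qed.

Lemma procomp1m P Q (f : prohom P Q) : prohom_eq (procomp (proid Q) f) f.
Proof. by move=> d; apply: germ_post_id. Qed.

Lemma procompm1 P Q (f : prohom P Q) : prohom_eq (procomp f (proid P)) f.
Proof.
move=> d; exists (projT1 (sval f d)); exists (dle_refl _); exists (dle_refl _) => /=.
by rewrite mcompm1.
Qed.

Definition Pro : category :=
  Category prohom_eq_equiv procomp_eq procompA procomp1m procompm1.

Lemma unit_anti (a b : unit) : True -> True -> a = b.
Proof. by case: a; case: b. Qed.

Definition unit_dirposet : dirposet :=
  @DirPoset unit (fun _ _ => True) (fun _ => I) (fun _ _ _ _ _ => I)
    unit_anti (ex_intro _ tt I) (fun _ _ => ex_intro _ tt (conj I I)).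

Lemma const_subproof (X : C) : idmor X \om idmor X =m idmor X.
Proof. exact: mcomp1m. Qed.

Definition pro_const (X : C) : proobj :=
  @ProObj unit_dirposet (fun _ => X) (fun _ _ _ => idmor X)
    (fun _ _ => heq_refl _) (fun _ _ _ _ _ _ => const_subproof X).

Definition is_cone (P : proobj) (L : C) (pi : forall a, mor L (P a)) :=
  forall (a b : pidx P) (h : dle a b), ptr h \om pi b =m pi a.

Definition is_limit (P : proobj) (L : C) (pi : forall a, mor L (P a)) :=
  is_cone pi /\
  forall (X : C) (x : forall a, mor X (P a)), is_cone x ->
    exists u : mor X L, (forall a, pi a \om u =m x a) /\
      forall v, (forall a, pi a \om v =m x a) -> v =m u.

Lemma cone_mor_subproof (P : proobj) (L : C) (pi : forall a, mor L (P a))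
  (pi_cone : is_cone pi) (d e : pidx P) (h : dle d e) :
  germ_eq (P := pro_const L)
    (germ_post (ptr h) (existT _ tt (pi e) : germ (pro_const L) (P e)))
    (existT _ tt (pi d)).
Proof. by exists tt, I, I => /=; rewrite (pi_cone _ _ h). Qed.

Definition cone_mor (P : proobj) (L : C) (pi : forall a, mor L (P a))
  (pi_cone : is_cone pi) : prohom (pro_const L) P :=
  exist _ (fun d => existT _ tt (pi d) : germ (pro_const L) (P d))
    (cone_mor_subproof pi_cone).

(* When L is a limit of P with projections pi, [cone_mor] is the adjunction
   morphism lim P -> P. *)
Definition limit_epi (P : proobj) :=
  exists (L : C) (pi : forall a, mor L (P a)) (H : is_limit pi),
    epi (C := Pro) (A := pro_const L) (B := P) (cone_mor (proj1 H)).

Definition Pro_le : category := full_subcat (C := Pro) limit_epi.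

End Pro.

Arguments pterm {C} p a.

Section FunCategory.
Variables (T A B : Type) (ev : T -> A -> B).

Lemma eqfun_equiv : Equivalence (fun f g : T => ev f =1 ev g).
Proof.
split; first by [].
- by move=> f g e x; rewrite e.
- by move=> f g h e e' x; rewrite e.
Qed.

End FunCategory.

Lemma eqfun_comp (A B C : Type) (g g' : B -> C) (f f' : A -> B) :
  g =1 g' -> f =1 f' -> g \o f =1 g' \o f'.
Proof. by move=> gg' ff' x /=; rewrite ff' gg'. Qed.

Definition Ab : category :=
  @Category zmodType (fun A B => {additive A -> B})
    (fun A B f g => f =1 g) (fun A => idfun) (fun _ _ _ g f => g \o f)
    (fun A B => eqfun_equiv (fun f : {additive A -> B} => f))
    (fun _ _ _ _ _ _ _ => @eqfun_comp _ _ _ _ _ _ _)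
    (fun _ _ _ _ _ _ _ _ => erefl) (fun _ _ _ _ => erefl)
    (fun _ _ _ _ => erefl).

Definition Vect (k : fieldType) : category :=
  @Category (lmodType k) (fun A B => {linear A -> B})
    (fun A B f g => f =1 g) (fun A => idfun) (fun _ _ _ g f => g \o f)
    (fun A B => eqfun_equiv (fun f : {linear A -> B} => f))
    (fun _ _ _ _ _ _ _ => @eqfun_comp _ _ _ _ _ _ _)
    (fun _ _ _ _ _ _ _ _ => erefl) (fun _ _ _ _ => erefl)
    (fun _ _ _ _ => erefl).

Notation "{ 'quot' U }" := (Quotient.quot U) : type_scope.

Section Quotient.
Variables (A : zmodType) (U : zmodClosed A).

Definition quot_pi (a : A) : {quot U} := \pi_({quot U}) a.

Lemma quot_pi_zmod_morphism : zmod_morphism quot_pi.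
Proof. exact: (pi_is_zmod_morphism {quot U}). Qed.

HB.instance Definition _ :=
  GRing.isZmodMorphism.Build A {quot U} quot_pi quot_pi_zmod_morphism.

Lemma quot_pi_repr (x : {quot U}) : quot_pi (repr x) = x.
Proof. exact: reprK. Qed.

Lemma quot_pi_eq a b : (quot_pi a = quot_pi b) <-> (a - b \in U).
Proof. by rewrite Quotient.idealrBE; split=> /eqP. Qed.

End Quotient.

Section QuotientMap.
Variables (A B : zmodType) (U : zmodClosed A) (V : zmodClosed B).
Variable f : {additive A -> B}.

Definition quot_map (fUV : forall x, x \in U -> f x \in V)
  (x : {quot U}) : {quot V} := quot_pi V (f (repr x)).

Variable fUV : forall x, x \in U -> f x \in V.

Lemma quot_mapE a : quot_map fUV (quot_pi U a) = quot_pi V (f a).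
Proof.
apply/quot_pi_eq; rewrite -raddfB; apply: fUV.
by apply/quot_pi_eq; apply: quot_pi_repr.
Qed.

Lemma quot_map_zmod_morphism : zmod_morphism (quot_map fUV).
Proof.
move=> x y; rewrite -[x]quot_pi_repr -[y]quot_pi_repr -raddfB.
by rewrite !quot_mapE !raddfB.
Qed.

HB.instance Definition _ :=
  GRing.isZmodMorphism.Build {quot U} {quot V} (quot_map fUV)
    quot_map_zmod_morphism.

End QuotientMap.

Section QuotientSpace.
Variables (k : fieldType) (A : lmodType k) (U : submodClosed A).

Definition submod_pred : {pred A} := U.

Lemma submod_pred_zmod_closed : zmod_closed submod_pred.
Proof.
split; first by change (0 \in U); apply: rpred0.
move=> x y xU yU; change (x - y \in U).
by rewrite -scaleN1r rpredD ?rpredZ.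
Qed.

HB.instance Definition _ :=
  GRing.isZmodClosed.Build A submod_pred submod_pred_zmod_closed.

Definition vquot : Type := {quot submod_pred}.
HB.instance Definition _ := GRing.Zmodule.on vquot.

Definition vquot_pi (a : A) : vquot := \pi_({quot submod_pred}) a.
Definition vquot_scale (c : k) (x : vquot) : vquot :=
  vquot_pi (c *: repr (x : {quot submod_pred})).

Lemma vquot_pi_repr (x : vquot) :
  vquot_pi (repr (x : {quot submod_pred})) = x.
Proof. exact: reprK. Qed.

Lemma vquot_pi_eq a b : (vquot_pi a = vquot_pi b) <-> (a - b \in U).
Proof.
rewrite -[a - b \in U]/(a - b \in submod_pred) Quotient.idealrBE.
by split=> /eqP.
Qed.

Lemma vquot_piB : {morph vquot_pi : a b / a - b}.
Proof. by move=> a b; apply: (raddfB \pi_({quot submod_pred})). Qed.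

Lemma vquot_piD : {morph vquot_pi : a b / a + b}.
Proof. by move=> a b; apply: (raddfD \pi_({quot submod_pred})). Qed.

Lemma vquot_scaleE c a : vquot_scale c (vquot_pi a) = vquot_pi (c *: a).
Proof.
apply/vquot_pi_eq; rewrite -scalerBr; apply: rpredZ.
by apply/vquot_pi_eq; apply: vquot_pi_repr.
Qed.

Lemma vquot_scaleA c d x :
  vquot_scale c (vquot_scale d x) = vquot_scale (c * d) x.
Proof. by rewrite -[x]vquot_pi_repr !vquot_scaleE scalerA. Qed.

Lemma vquot_scale1 : left_id 1 vquot_scale.
Proof. by move=> x; rewrite -[x]vquot_pi_repr vquot_scaleE scale1r. Qed.

Lemma vquot_scaleDr : right_distributive vquot_scale +%R.
Proof.
move=> c x y; rewrite -[x]vquot_pi_repr -[y]vquot_pi_repr.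
by rewrite -vquot_piD !vquot_scaleE -vquot_piD scalerDr.
Qed.

Lemma vquot_scaleDl x : {morph vquot_scale^~ x : c d / c + d}.
Proof.
move=> c d; rewrite -[x]vquot_pi_repr !vquot_scaleE.
by rewrite -vquot_piD scalerDl.
Qed.

HB.instance Definition _ := GRing.Zmodule_isLmodule.Build k vquot
  vquot_scaleA vquot_scale1 vquot_scaleDr vquot_scaleDl.

Lemma vquot_pi_linear : linear vquot_pi.
Proof. by move=> c x y; rewrite vquot_piD -vquot_scaleE. Qed.

HB.instance Definition _ := GRing.isLinear.Build k A vquot _ vquot_pi
  vquot_pi_linear.

End QuotientSpace.

Section QuotientSpaceMap.
Variables (k : fieldType) (A B : lmodType k).
Variables (U : submodClosed A) (V : submodClosed B) (f : {linear A -> B}).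

Definition vquot_map (fUV : forall x, x \in U -> f x \in V)
  (x : vquot U) : vquot V :=
  vquot_pi V (f (repr (x : {quot submod_pred U}))).

Variable fUV : forall x, x \in U -> f x \in V.

Lemma vquot_mapE a : vquot_map fUV (vquot_pi U a) = vquot_pi V (f a).
Proof.
apply/vquot_pi_eq; rewrite -raddfB; apply: fUV.
by apply/vquot_pi_eq; apply: vquot_pi_repr.
Qed.

Lemma vquot_map_linear : linear (vquot_map fUV).
Proof.
move=> c x y; rewrite -[x]vquot_pi_repr -[y]vquot_pi_repr -linearP.
by rewrite !vquot_mapE !linearP.
Qed.

HB.instance Definition _ :=
  GRing.isLinear.Build k (vquot U) (vquot V) _ (vquot_map fUV)
    vquot_map_linear.

End QuotientSpaceMap.

Record open_subgroup (A : topologicalZmodType) := OpenSubgroup {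
  os_sub :> zmodClosed A;
  os_open : open [set x | x \in os_sub]
}.

Section OpenSubgroups.
Variable A : topologicalZmodType.
Implicit Types U V W : open_subgroup A.

(* The smaller subgroup is the larger index. *)
Definition os_le U V := forall x, x \in V -> x \in U.

Lemma os_le_refl U : os_le U U.
Proof. by []. Qed.

Lemma os_le_trans U V W : os_le U V -> os_le V W -> os_le U W.
Proof. by move=> UV VW x /VW /UV. Qed.

Lemma os_le_anti U V : os_le U V -> os_le V U -> U = V.
Proof.
case: U V => [[s cs] os] [[t ct] ot] st ts.
have e : s = t.
  by apply: funext => x; apply/idP/idP => [/ts|/st].
case: _ / e in ct ot {st ts} *.
have e : cs = ct.
  case: cs ct {os ot} => [[m1] [m2]] [[n1] [n2]].
  by rewrite (Prop_irrelevance m1 n1) (Prop_irrelevance m2 n2).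
case: _ / e in ot *.
by congr OpenSubgroup; apply: Prop_irrelevance.
Qed.

Definition osT_pred : {pred A} := predT.

Lemma osT_zmod_closed : zmod_closed osT_pred.
Proof. by []. Qed.

HB.instance Definition _ :=
  GRing.isZmodClosed.Build A osT_pred osT_zmod_closed.

Lemma osT_open : open [set x | x \in osT_pred].
Proof. by rewrite (_ : [set x | _] = setT) ?eqEsubset //; apply: openT. Qed.

Definition osT : open_subgroup A := OpenSubgroup osT_open.

Section Inter.
Variables U V : open_subgroup A.

Definition osI_pred : {pred A} := [pred x | (x \in U) && (x \in V)].

Lemma osI_zmod_closed : zmod_closed osI_pred.
Proof.
split; first by rewrite inE !rpred0.
by move=> x y /andP[xU xV] /andP[yU yV]; rewrite inE !rpredB.
Qed.

HB.instance Definition _ :=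
  GRing.isZmodClosed.Build A osI_pred osI_zmod_closed.

Lemma osI_open : open [set x | x \in osI_pred].
Proof.
have := openI (os_open U) (os_open V); congr open.
by apply/seteqP; split => x /=; rewrite inE => /andP.
Qed.

Definition osI : open_subgroup A := OpenSubgroup osI_open.

End Inter.

Lemma os_directed U V : exists W, os_le U W /\ os_le V W.
Proof.
by exists (osI U V); split => x xW; case/andP: (xW : x \in osI_pred U V).
Qed.

Definition os_dirposet : dirposet :=
  DirPoset os_le_refl os_le_trans os_le_anti (ex_intro _ osT I) os_directed.

Definition os_tr U V (h : os_le U V) : {additive {quot V} -> {quot U}} :=
  quot_map (f := idfun) h.

Lemma os_trE U V (h : os_le U V) (a : A) : os_tr h (quot_pi V a) = quot_pi U a.
Proof. exact: quot_mapE. Qed.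

Lemma os_tr1 U (h : os_le U U) : os_tr h =1 idfun.
Proof. by move=> x; rewrite -[x]quot_pi_repr os_trE. Qed.

Lemma os_trM U V W (hUV : os_le U V) (hVW : os_le V W) (hUW : os_le U W) :
  os_tr hUV \o os_tr hVW =1 os_tr hUW.
Proof. by move=> x; rewrite -[x]quot_pi_repr /= !quot_mapE. Qed.

Definition quot_system : proobj Ab :=
  @ProObj Ab os_dirposet (fun U => {quot U} : zmodType) os_tr os_tr1 os_trM.

Definition os_compatible (x : forall U : open_subgroup A, {quot U}) :=
  forall U V (h : os_le U V), os_tr h (x V) = x U.

Definition completion := {x | os_compatible x}.

Lemma os_compatible_pi (a : A) : os_compatible (fun U => quot_pi U a).
Proof. by move=> U V h; apply: os_trE. Qed.

Definition completion_map (a : A) : completion :=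
  exist _ _ (os_compatible_pi a).

End OpenSubgroups.

Definition linear_topology (A : topologicalZmodType) :=
  forall N : set A, nbhs (0 : A) N ->
    exists U : open_subgroup A, [set x | x \in U] `<=` N.

Definition is_separated (A : topologicalZmodType) :=
  injective (@completion_map A).

Definition is_complete (A : topologicalZmodType) :=
  forall x : completion A, exists a : A, completion_map a = x.

Record topsc_group := TopscGroup {
  tg_sort :> topologicalZmodType;
  tg_linear : linear_topology tg_sort;
  tg_separated : is_separated tg_sort;
  tg_complete : is_complete tg_sort
}.

Record cont_additive (A B : topologicalZmodType) := ContAdditive {
  ca_map :> {additive A -> B};
  ca_cont : continuous ca_map
}.

Lemma id_cont (A : topologicalType) : continuous (idfun : A -> A).
Proof. by move=> x; apply: cvg_id. Qed.

Lemma comp_cont (A B C : topologicalType) (g : B -> C) (f : A -> B) :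
  continuous g -> continuous f -> continuous (g \o f).
Proof. by move=> cg cf x; apply: continuous_comp; [apply: cf | apply: cg]. Qed.

Definition ca_id (A : topologicalZmodType) : cont_additive A A :=
  @ContAdditive A A idfun (@id_cont A).

Definition ca_comp (A B C : topologicalZmodType)
  (g : cont_additive B C) (f : cont_additive A B) : cont_additive A C :=
  @ContAdditive A C (g \o f) (comp_cont (@ca_cont B C g) (@ca_cont A B f)).

Definition TopscZ : category :=
  @Category topsc_group (fun A B => cont_additive A B)
    (fun A B f g => f =1 g) (fun A => ca_id A)
    (fun _ _ _ g f => ca_comp g f)
    (fun A B => eqfun_equiv (fun f : cont_additive A B => f))
    (fun _ _ _ _ _ _ _ => @eqfun_comp _ _ _ _ _ _ _)
    (fun _ _ _ _ _ _ _ _ => erefl) (fun _ _ _ _ => erefl)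
    (fun _ _ _ _ => erefl).

Section OpenSubgroupPreimage.
Variables (A B : topologicalZmodType) (f : cont_additive A B).
Variable V : open_subgroup B.

Definition os_preim_pred : {pred A} := [pred x | f x \in V].

Lemma os_preim_zmod_closed : zmod_closed os_preim_pred.
Proof.
split; first by rewrite inE raddf0 rpred0.
by move=> x y; rewrite !inE raddfB => xV yV; apply: rpredB.
Qed.

HB.instance Definition _ :=
  GRing.isZmodClosed.Build A os_preim_pred os_preim_zmod_closed.

Lemma os_preim_open : open [set x | x \in os_preim_pred].
Proof.
have /continuousP/(_ _ (os_open V)) := @ca_cont A B f.
by congr open.
Qed.

Definition os_preim : open_subgroup A := OpenSubgroup os_preim_open.

Definition os_preim_map : {additive {quot os_preim} -> {quot V}} :=
  @quot_map A B os_preim V f (fun x (h : x \in os_preim) => h).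

Lemma os_preim_mapE (a : A) : os_preim_map (quot_pi os_preim a) = quot_pi V (f a).
Proof. exact: quot_mapE. Qed.

End OpenSubgroupPreimage.

Lemma germ_Ab_eq (A : topologicalZmodType) (X : zmodType)
  (u v : germ (quot_system A) (X : Ab)) :
  (forall a : A, projT2 u (quot_pi (projT1 u) a) =
                 projT2 v (quot_pi (projT1 v) a)) -> germ_eq u v.
Proof.
move=> e.
have [c [hu hv]] := dp_directed (projT1 u) (projT1 v).
exists c, hu, hv => x /=; rewrite -[x]quot_pi_repr.
by rewrite [os_tr hu _]os_trE [os_tr hv _]os_trE e.
Qed.

Section QuotientSystemMap.
Variables (A B : topologicalZmodType) (f : cont_additive A B).

Definition quot_system_germ (V : open_subgroup B) :
  germ (quot_system A) ({quot V} : Ab) :=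
  existT (fun U : open_subgroup A => {additive {quot U} -> {quot V}})
    (os_preim f V) (os_preim_map f V).

Lemma quot_system_subproof (U V : open_subgroup B) (h : os_le U V) :
  germ_eq (germ_post (os_tr h : mor (_ : Ab) _) (quot_system_germ V))
    (quot_system_germ U).
Proof.
apply: germ_Ab_eq => a /=.
by rewrite !quot_mapE.
Qed.

Definition quot_system_map : prohom (quot_system A) (quot_system B) :=
  exist _ quot_system_germ quot_system_subproof.

End QuotientSystemMap.

Lemma quot_system_map_eq (A B : TopscZ) (f g : mor A B) :
  f =m g -> prohom_eq (quot_system_map f) (quot_system_map g).
Proof.
by move=> e V; apply: germ_Ab_eq => a; rewrite /= !quot_mapE e.
Qed.

Lemma quot_system_map1 (A : TopscZ) :
  prohom_eq (quot_system_map (idmor A)) (proid (quot_system A)).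
Proof. by move=> V; apply: germ_Ab_eq => a; rewrite /= quot_mapE. Qed.

Lemma quot_system_mapM (X Y Z : TopscZ) (g : mor Y Z) (f : mor X Y) :
  prohom_eq (quot_system_map (g \om f))
    (procomp (quot_system_map g) (quot_system_map f)).
Proof. by move=> V; apply: germ_Ab_eq => a; rewrite /= !quot_mapE. Qed.

(* A is sent to the pro-object of its quotients by the open subgroups. *)
Definition TopscZ_Pro : functor TopscZ (Pro Ab) :=
  @Functor TopscZ (Pro Ab) (fun A => quot_system A)
    (fun A B f => quot_system_map f)
    quot_system_map_eq quot_system_map1 quot_system_mapM.

(* [k] carries the discrete topology.  Continuity of the scalar multiplication
   then follows from [vlinear_topology] below, and is not required here. *)
Record topLmod (k : fieldType) := TopLmod {
  tl_base : topologicalZmodType;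
  tl_lmod : GRing.Zmodule_isLmodule k tl_base
}.

Definition tl_sort (k : fieldType) (V : topLmod k) : Type := tl_base V.
Coercion tl_sort : topLmod >-> Sortclass.
HB.instance Definition _ k (V : topLmod k) :=
  TopologicalZmodule.on (tl_sort V).
HB.instance Definition _ k (V : topLmod k) :=
  tl_lmod V : GRing.Zmodule_isLmodule k (tl_sort V).

Record open_subspace (k : fieldType) (A : topLmod k) := OpenSubspace {
  ov_sub :> submodClosed A;
  ov_open : open [set x | x \in ov_sub]
}.

Section OpenSubspaces.
Variables (k : fieldType) (A : topLmod k).
Implicit Types U V W : open_subspace A.

(* The smaller subspace is the larger index. *)
Definition ov_le U V := forall x, x \in V -> x \in U.

Lemma ov_le_refl U : ov_le U U.
Proof. by []. Qed.

Lemma ov_le_trans U V W : ov_le U V -> ov_le V W -> ov_le U W.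
Proof. by move=> UV VW x /VW /UV. Qed.

Lemma ov_le_anti U V : ov_le U V -> ov_le V U -> U = V.
Proof.
case: U V => [[s cs] os] [[t ct] ot] st ts.
have e : s = t.
  by apply: funext => x; apply/idP/idP => [/ts|/st].
case: _ / e in ct ot {st ts} *.
have e : cs = ct.
  case: cs ct {os ot} => [[m1] [m2]] [[n1] [n2]].
  by rewrite (Prop_irrelevance m1 n1) (Prop_irrelevance m2 n2).
case: _ / e in ot *.
by congr OpenSubspace; apply: Prop_irrelevance.
Qed.

Definition ovT_pred : {pred A} := predT.

Lemma ovT_submod_closed : submod_closed ovT_pred.
Proof. by []. Qed.

HB.instance Definition _ :=
  GRing.isSubmodClosed.Build k A ovT_pred ovT_submod_closed.

Lemma ovT_open : open [set x | x \in ovT_pred].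
Proof. by rewrite (_ : [set x | _] = setT) ?eqEsubset //; apply: openT. Qed.

Definition ovT : open_subspace A := OpenSubspace ovT_open.

Section Inter.
Variables U V : open_subspace A.

Definition ovI_pred : {pred A} := [pred x | (x \in U) && (x \in V)].

Lemma ovI_submod_closed : submod_closed ovI_pred.
Proof.
split; first by rewrite inE !rpred0.
move=> c x y /andP[xU xV] /andP[yU yV].
by rewrite inE !rpredD ?rpredZ.
Qed.

HB.instance Definition _ :=
  GRing.isSubmodClosed.Build k A ovI_pred ovI_submod_closed.

Lemma ovI_open : open [set x | x \in ovI_pred].
Proof.
have := openI (ov_open U) (ov_open V); congr open.
by apply/seteqP; split => x /=; rewrite inE => /andP.
Qed.

Definition ovI : open_subspace A := OpenSubspace ovI_open.

End Inter.

Lemma ov_directed U V : exists W, ov_le U W /\ ov_le V W.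
Proof.
by exists (ovI U V); split => x xW; case/andP: (xW : x \in ovI_pred U V).
Qed.

Definition ov_dirposet : dirposet :=
  DirPoset ov_le_refl ov_le_trans ov_le_anti (ex_intro _ ovT I) ov_directed.

Definition ov_tr U V (h : ov_le U V) : {linear vquot V -> vquot U} :=
  vquot_map (f := idfun) h.

Lemma ov_trE U V (h : ov_le U V) (a : A) :
  ov_tr h (vquot_pi V a) = vquot_pi U a.
Proof. exact: vquot_mapE. Qed.

Lemma ov_tr1 U (h : ov_le U U) : ov_tr h =1 idfun.
Proof. by move=> x; rewrite -[x]vquot_pi_repr ov_trE. Qed.

Lemma ov_trM U V W (hUV : ov_le U V) (hVW : ov_le V W) (hUW : ov_le U W) :
  ov_tr hUV \o ov_tr hVW =1 ov_tr hUW.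
Proof. by move=> x; rewrite -[x]vquot_pi_repr /= !vquot_mapE. Qed.

Definition vquot_system : proobj (Vect k) :=
  @ProObj (Vect k) ov_dirposet (fun U => vquot U : lmodType k)
    ov_tr ov_tr1 ov_trM.

Definition ov_compatible (x : forall U : open_subspace A, vquot U) :=
  forall U V (h : ov_le U V), ov_tr h (x V) = x U.

Definition vcompletion := {x | ov_compatible x}.

Lemma ov_compatible_pi (a : A) : ov_compatible (fun U => vquot_pi U a).
Proof. by move=> U V h; apply: ov_trE. Qed.

Definition vcompletion_map (a : A) : vcompletion :=
  exist _ _ (ov_compatible_pi a).

End OpenSubspaces.

Definition vlinear_topology (k : fieldType) (A : topLmod k) :=
  forall N : set A, nbhs (0 : A) N ->
    exists U : open_subspace A, [set x | x \in U] `<=` N.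

Definition is_vseparated (k : fieldType) (A : topLmod k) :=
  injective (@vcompletion_map k A).

Definition is_vcomplete (k : fieldType) (A : topLmod k) :=
  forall x : vcompletion A, exists a : A, vcompletion_map a = x.

Record topsc_space (k : fieldType) := TopscSpace {
  ts_sort :> topLmod k;
  ts_linear : vlinear_topology ts_sort;
  ts_separated : is_vseparated ts_sort;
  ts_complete : is_vcomplete ts_sort
}.

Record cont_linear (k : fieldType) (A B : topLmod k) := ContLinear {
  cl_map :> {linear A -> B};
  cl_cont : continuous cl_map
}.

Definition cl_id (k : fieldType) (A : topLmod k) : cont_linear A A :=
  @ContLinear k A A idfun (@id_cont A).

Definition cl_comp (k : fieldType) (A B C : topLmod k)
  (g : cont_linear B C) (f : cont_linear A B) : cont_linear A C :=
  @ContLinear k A C (g \o f) (comp_cont (@cl_cont k B C g) (@cl_cont k A B f)).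

Definition TopscVect (k : fieldType) : category :=
  @Category (topsc_space k) (fun A B => cont_linear A B)
    (fun A B f g => f =1 g) (fun A => cl_id A)
    (fun _ _ _ g f => cl_comp g f)
    (fun A B => eqfun_equiv (fun f : cont_linear A B => f))
    (fun _ _ _ _ _ _ _ => @eqfun_comp _ _ _ _ _ _ _)
    (fun _ _ _ _ _ _ _ _ => erefl) (fun _ _ _ _ => erefl)
    (fun _ _ _ _ => erefl).

Section OpenSubspacePreimage.
Variables (k : fieldType) (A B : topLmod k) (f : cont_linear A B).
Variable V : open_subspace B.

Definition ov_preim_pred : {pred A} := [pred x | f x \in V].

Lemma ov_preim_submod_closed : submod_closed ov_preim_pred.
Proof.
split; first by rewrite inE raddf0 rpred0.
by move=> c x y; rewrite !inE linearP => xV yV; rewrite rpredD ?rpredZ.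
Qed.

HB.instance Definition _ :=
  GRing.isSubmodClosed.Build k A ov_preim_pred ov_preim_submod_closed.

Lemma ov_preim_open : open [set x | x \in ov_preim_pred].
Proof.
have /continuousP/(_ _ (ov_open V)) := @cl_cont k A B f.
by congr open.
Qed.

Definition ov_preim : open_subspace A := OpenSubspace ov_preim_open.

Definition ov_preim_map : {linear vquot ov_preim -> vquot V} :=
  @vquot_map k A B ov_preim V f (fun x (h : x \in ov_preim) => h).

Lemma ov_preim_mapE (a : A) :
  ov_preim_map (vquot_pi ov_preim a) = vquot_pi V (f a).
Proof. exact: vquot_mapE. Qed.

End OpenSubspacePreimage.

Lemma germ_Vect_eq (k : fieldType) (A : topLmod k) (X : lmodType k)
  (u v : germ (vquot_system A) (X : Vect k)) :
  (forall a : A, projT2 u (vquot_pi (projT1 u) a) =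
                 projT2 v (vquot_pi (projT1 v) a)) -> germ_eq u v.
Proof.
move=> e.
have [c [hu hv]] := dp_directed (projT1 u) (projT1 v).
exists c, hu, hv => x /=; rewrite -[x]vquot_pi_repr.
by rewrite [ov_tr hu _]ov_trE [ov_tr hv _]ov_trE e.
Qed.

Section QuotientSpaceSystemMap.
Variables (k : fieldType) (A B : topLmod k) (f : cont_linear A B).

Definition vquot_system_germ (V : open_subspace B) :
  germ (vquot_system A) (vquot V : Vect k) :=
  existT (fun U : open_subspace A => {linear vquot U -> vquot V})
    (ov_preim f V) (ov_preim_map f V).

Lemma vquot_system_subproof (U V : open_subspace B) (h : ov_le U V) :
  germ_eq (germ_post (ov_tr h : mor (_ : Vect k) _) (vquot_system_germ V))
    (vquot_system_germ U).
Proof.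
apply: germ_Vect_eq => a /=.
by rewrite !vquot_mapE.
Qed.

Definition vquot_system_map : prohom (vquot_system A) (vquot_system B) :=
  exist _ vquot_system_germ vquot_system_subproof.

End QuotientSpaceSystemMap.

Section TopscVectPro.
Variable k : fieldType.

Lemma vquot_system_map_eq (A B : TopscVect k) (f g : mor A B) :
  f =m g -> prohom_eq (vquot_system_map f) (vquot_system_map g).
Proof.
by move=> e V; apply: germ_Vect_eq => a; rewrite /= !vquot_mapE e.
Qed.

Lemma vquot_system_map1 (A : TopscVect k) :
  prohom_eq (vquot_system_map (idmor A)) (proid (vquot_system A)).
Proof. by move=> V; apply: germ_Vect_eq => a; rewrite /= vquot_mapE. Qed.

Lemma vquot_system_mapM (X Y Z : TopscVect k) (g : mor Y Z) (f : mor X Y) :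
  prohom_eq (vquot_system_map (g \om f))
    (procomp (vquot_system_map g) (vquot_system_map f)).
Proof. by move=> V; apply: germ_Vect_eq => a; rewrite /= !vquot_mapE. Qed.

(* A is sent to the pro-object of its quotients by the open subspaces. *)
Definition TopscVect_Pro : functor (TopscVect k) (Pro (Vect k)) :=
  @Functor (TopscVect k) (Pro (Vect k)) (fun A => vquot_system A)
    (fun A B f => vquot_system_map f)
    vquot_system_map_eq vquot_system_map1 vquot_system_mapM.

End TopscVectPro.

(* Main.v *)
From HB Require Import structures.
From mathcomp Require Import all_boot all_algebra.
From mathcomp Require Import boolp classical_sets functions topology tvs.
Require Import Defs.

Set Implicit Arguments.
Unset Strict Implicit.
Unset Printing Implicit Defensive.

Import GRing.Theory.
Local Open Scope classical_set_scope.
Local Open Scope ring_scope.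
Local Open Scope cat_scope.

(** A short sequence [A' -> A -> A''] of complete separated groups satisfies Ex1
exactly when [A'] carries the topology induced from the kernel of [p], [p] has
dense image, and for every open [U] in [A] some open [W] in [A''] has its
preimage contained in [i(A') + U] ([strictly_exact], [Ex1_strictly]).  These
are statements about the quotients [A'/U'], [A/U], [A''/W], and they are
precisely what makes the sequence of pro-objects exact
([strictly_germwise], [ge_exact]).  Conversely the functor to pro-objects is
fully faithful and respects zero morphisms, so it reflects kernels and
cokernels ([reflect_exact]).  This is [exact_pro_Ex1].

The conditions ask [p] to have dense image, not to be onto, and this is what
breaks the axioms of an exact structure.  Suppose that [p : A -> A''] belongs
to such a sequence, that [f : K -> A''] comes from a discrete group [K <> 0],
and that [f c] is in the image of [p] only for [c = 0].  If [q : B -> K] is an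
epimorphism which fits into a commutative square with [f], [p] and some
[g : B -> A], then an element [b] of [B] with [q b <> 0] gives [p (g b) = f (q b)],
a contradiction.  Hence [p] has no pullback along [f] which is again an
admissible epimorphism.  The same argument works for a limit-epimorphic
pro-object [B], because such a [B] has enough elements in its limit
([gap_no_pro_square]).  In all pro-objects, however, the pullback [B] does
exist and is an extension of [K] by [A'] ([pull_exact]); so [B] is not
limit-epimorphic, and closure under extensions fails.

The sequence is obtained as follows.  Let [A] be the space of finitely
supported functions on [N x N], in the topology whose basic open subspaces
consist of the functions that vanish on the rows [t < m] and on the entries
[n < phi t], for [m : nat] and [phi : nat -> nat].  It is complete: the limit
of a Cauchy family is supported under the graph of some [phi], so it
coincides with a member of the family, which is finitely supported
([restr_complete]).  Let [p] send a function to the sequence of its row sums,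
in the product [A''] of countably many copies of [k].  The image consists of
finitely supported sequences; it is dense, and it contains no nonzero
constant sequence.

Abelian groups and vector spaces are treated at the same time: the argument is
carried out for an abstract category of modules [module_category] and an
abstract category of complete separated linear topologies on its objects
[topological_category], and both are instantiated twice. *)

(** * Categories of modules *)

(** What abelian groups and vector spaces have in common.  The field [fill]
constructs all the morphisms below: the relation [h_j y = g_j x for all j] from
[x] to [y], followed by [f], is a morphism as soon as it is total and
single-valued. *)
Record module_category := ModuleCategory {
  mc_cat :> category;
  elt : mc_cat -> zmodType;
  act : forall A B : mc_cat, mor A B -> {additive elt A -> elt B};
  act_heq : forall (A B : mc_cat) (f g : mor A B), f =m g <-> act f =1 act g;
  act_id : forall A : mc_cat, act (idmor A) =1 id;
  act_comp : forall (X Y Z : mc_cat) (g : mor Y Z) (f : mor X Y),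
    act (g \om f) =1 act g \o act f;
  zmap : forall A B : mc_cat, mor A B;
  zmapE : forall (A B : mc_cat) (x : elt A), act (zmap A B) x = 0;
  fill : forall (X Y Z : mc_cat) (J : Type) (W : J -> mc_cat)
      (f : mor Y Z) (h : forall j, mor Y (W j)) (g : forall j, mor X (W j)),
    (forall x, exists y, forall j, act (h j) y = act (g j) x) ->
    (forall y, (forall j, act (h j) y = 0) -> act f y = 0) ->
    exists u : mor X Z,
      forall x y, (forall j, act (h j) y = act (g j) x) -> act u x = act f y;
  coker_ex : forall (A B : mc_cat) (f : mor A B),
    exists (Q : mc_cat) (q : mor B Q), (forall z, exists b, act q b = z) /\
      forall b, act q b = 0 <-> exists a, act f a = b;
  pb : forall A B W : mc_cat, mor A W -> mor B W -> mc_cat;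
  pb1 : forall (A B W : mc_cat) (f : mor A W) (g : mor B W), mor (pb f g) A;
  pb2 : forall (A B W : mc_cat) (f : mor A W) (g : mor B W), mor (pb f g) B;
  pb_comm : forall (A B W : mc_cat) (f : mor A W) (g : mor B W) x,
    act f (act (pb1 f g) x) = act g (act (pb2 f g) x);
  pb_inj : forall (A B W : mc_cat) (f : mor A W) (g : mor B W) x,
    act (pb1 f g) x = 0 -> act (pb2 f g) x = 0 -> x = 0;
  pb_elt : forall (A B W : mc_cat) (f : mor A W) (g : mor B W) a b,
    act f a = act g b ->
    exists x, act (pb1 f g) x = a /\ act (pb2 f g) x = b
}.

Notation "f @@ x" := (act f x) (at level 35, right associativity) : cat_scope.

Section ModuleCategory.
Variable C : module_category.

Lemma comp_act (X Y Z : C) (g : mor Y Z) (f : mor X Y) x :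
  (g \om f) @@ x = g @@ f @@ x.
Proof. exact: act_comp. Qed.

Lemma heqP (A B : C) (f g : mor A B) : f =m g <-> forall x, f @@ x = g @@ x.
Proof. exact: act_heq. Qed.

Lemma fill1 (X Y Z W : C) (f : mor Y Z) (h : mor Y W) (g : mor X W) :
  (forall x, exists y, h @@ y = g @@ x) ->
  (forall y, h @@ y = 0 -> f @@ y = 0) ->
  exists u : mor X Z, forall x y, h @@ y = g @@ x -> u @@ x = f @@ y.
Proof.
move=> e k.
have [x||u hu] := @fill C X Y Z unit (fun=> W) f (fun=> h) (fun=> g).
- by have [y ey] := e x; exists y.
- by move=> y ey; apply: k; apply: ey tt.
by exists u => x y ey; apply: hu.
Qed.

Lemma pb_eq (A B W : C) (f : mor A W) (g : mor B W) x y :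
  pb1 f g @@ x = pb1 f g @@ y -> pb2 f g @@ x = pb2 f g @@ y -> x = y.
Proof.
move=> e1 e2; apply/eqP; rewrite -subr_eq0; apply/eqP.
by apply: (@pb_inj _ _ _ _ f g); rewrite raddfB ?e1 ?e2 subrr.
Qed.

(** The pullback is given by its elements; its universal property follows from
[fill] applied to the pair of projections. *)
Lemma pb_lift (X A B W : C) (f : mor A W) (g : mor B W)
    (x : mor X A) (y : mor X B) :
  (forall t, f @@ x @@ t = g @@ y @@ t) ->
  exists u : mor X (pb f g),
    forall t, pb1 f g @@ u @@ t = x @@ t /\ pb2 f g @@ u @@ t = y @@ t.
Proof.
move=> e; pose V (b : bool) := if b then A else B.
pose h b : mor (pb f g) (V b) :=
  if b as b0 return mor _ (V b0) then pb1 f g else pb2 f g.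
pose z b : mor X (V b) := if b as b0 return mor _ (V b0) then x else y.
have [t||u hu] := @fill C X (pb f g) (pb f g) bool V (idmor _) h z.
- by have [s [s1 s2]] := pb_elt (e t); exists s => -[].
- by move=> s hs; rewrite act_id (pb_inj (hs true) (hs false)).
exists u => t; have [s [s1 s2]] := pb_elt (e t).
by rewrite (hu t s) ?act_id // => -[].
Qed.

End ModuleCategory.

(** * Germs and zero morphisms of pro-objects *)

Section ProModule.
Variable C : module_category.
Implicit Types P Q R X : proobj C.

Lemma tr_tr P (a b c : pidx P) (hab : dle a b) (hbc : dle b c) (hac : dle a c) x :
  ptr hab @@ ptr hbc @@ x = ptr hac @@ x.
Proof. by rewrite -comp_act; move: x; apply/heqP; apply: ptrM. Qed.

Lemma tr_id P (a : pidx P) (h : dle a a) x : ptr h @@ x = x.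
Proof. by rewrite -[RHS]act_id; move: x; apply/heqP; apply: ptr1. Qed.

Lemma germ_eqP P (Z : C) (u v : germ P Z) : germ_eq u v <->
  exists (c : pidx P) (hu : dle (projT1 u) c) (hv : dle (projT1 v) c),
    forall x, projT2 u @@ ptr hu @@ x = projT2 v @@ ptr hv @@ x.
Proof.
split=> -[c [hu [hv e]]]; exists c, hu, hv.
- by move=> x; rewrite -!comp_act; apply/heqP: x.
- by apply/heqP => x; rewrite !comp_act.
Qed.

(** A germ has many representatives, one for each sufficiently large index; the
proofs below pass to larger indices by the next few lemmas instead of choosing
canonical ones. *)
Definition represents P (Z : C) (u : germ P Z) (c : pidx P) (m : mor (P c) Z) :=
  germ_eq (existT _ c m) u.

Lemma rep_self P (Z : C) (u : germ P Z) : represents u (projT2 u).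
Proof. by case: u => c m; apply: germ_eq_refl. Qed.

(** The indices past which two representatives agree form an up-set, so that
several such agreements can be combined. *)
Lemma rep_agree P (Z : C) (u : germ P Z) c c' (m : mor (P c) Z) (m' : mor (P c') Z) :
  represents u m -> represents u m' ->
  exists d, dle c d /\ dle c' d /\
    forall e (_ : dle d e) (h : dle c e) (h' : dle c' e) x,
    m @@ ptr h @@ x = m' @@ ptr h' @@ x.
Proof.
move=> um um'.
have /germ_eqP[d [/= h [h' e]]] := germ_eq_trans um (germ_eq_sym um').
exists d; do 2!split=> //; move=> d' k k1 k2 x.
by rewrite -(tr_tr h k) -(tr_tr h' k) e.
Qed.

Lemma rep_shift P (Z : C) (u : germ P Z) c c' (m : mor (P c) Z) (h : dle c c') :
  represents u m -> represents u (m \om ptr h).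
Proof.
apply: germ_eq_trans; apply/germ_eqP.
by exists c', (dle_refl c'), h => x /=; rewrite comp_act tr_id.
Qed.

Lemma rep_above P (Z : C) (u : germ P Z) (a : pidx P) :
  exists c (m : mor (P c) Z), dle a c /\ represents u m.
Proof.
have [c [h h']] := dp_directed a (projT1 u).
by exists c, (projT2 u \om ptr h'); split=> //; apply: rep_shift (rep_self u).
Qed.

Lemma rep_comp P Q R (g : prohom Q R) (f : prohom P Q) d b c
    (n : mor (Q b) (R d)) (m : mor (P c) (Q b)) :
  represents (sval g d) n -> represents (sval f b) m ->
  represents (sval (procomp g f) d) (n \om m).
Proof.
move=> gn fm.
apply: germ_eq_trans (germ_pull_eq gn (prohom_refl f)).
exact: germ_post_eq (heq_refl n) fm.
Qed.

Lemma rep_tr P Q (f : prohom P Q) a b (h : dle a b) c (m : mor (P c) (Q b)) :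
  represents (sval f b) m -> represents (sval f a) (ptr h \om m).
Proof.
move=> fm; apply: germ_eq_trans (svalP f _ _ h).
exact: germ_post_eq (heq_refl (ptr h)) fm.
Qed.

Lemma rep_eq P (Z : C) (u v : germ P Z) c (m : mor (P c) Z) c' (m' : mor (P c') Z) :
  represents u m -> represents v m' ->
  (exists d (h : dle c d) (h' : dle c' d),
    forall x, m @@ ptr h @@ x = m' @@ ptr h' @@ x) ->
  germ_eq u v.
Proof.
move=> um vm' e; apply: germ_eq_trans (germ_eq_sym um) _.
by apply: germ_eq_trans vm'; apply/germ_eqP.
Qed.

Lemma rep_germ_eq P (Z : C) (u v : germ P Z) c (m : mor (P c) Z) :
  germ_eq u v -> represents u m -> represents v m.
Proof. by move=> e um; apply: germ_eq_trans um e. Qed.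

Definition zero_germ P (Z : C) (u : germ P Z) :=
  exists (c : pidx P) (h : dle (projT1 u) c), forall x, projT2 u @@ ptr h @@ x = 0.

Definition pro_zero P Q (f : prohom P Q) := forall d, zero_germ (sval f d).

Lemma zero_germ_rep P (Z : C) (u : germ P Z) c (m : mor (P c) Z) :
  represents u m -> zero_germ u ->
  exists d, dle c d /\ forall e (_ : dle d e) (h : dle c e) x, m @@ ptr h @@ x = 0.
Proof.
move=> um [c' [h' e]].
have [d [h1 [h2 ed]]] := rep_agree um (rep_self u).
have [d' [dd' c'd']] := dp_directed d c'.
exists d'; split=> [|e' d'e' ce' x]; first exact: dle_trans dd'.
rewrite (ed e' (dle_trans dd' d'e') ce' (dle_trans h' (dle_trans c'd' d'e'))).
by rewrite -(tr_tr h' (dle_trans c'd' d'e')) e.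
Qed.

Lemma rep_zero_germ P (Z : C) (u : germ P Z) c (m : mor (P c) Z) :
  represents u m -> (forall x, m @@ x = 0) -> zero_germ u.
Proof.
move=> um m0; have [d [h1 [h2 e]]] := rep_agree um (rep_self u).
by exists d, h2 => x; rewrite -(e d (dle_refl d) h1) m0.
Qed.

Lemma zero_germ_eq P (Z : C) (u v : germ P Z) :
  zero_germ u -> zero_germ v -> germ_eq u v.
Proof.
move=> [c [h e]] [c' [h' e']]; have [d [cd c'd]] := dp_directed c c'.
apply/germ_eqP; exists d, (dle_trans h cd), (dle_trans h' c'd) => x.
by rewrite -(tr_tr h cd) -(tr_tr h' c'd) e e'.
Qed.

Lemma zero_germ_of_eq P (Z : C) (u v : germ P Z) :
  germ_eq u v -> zero_germ u -> zero_germ v.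
Proof.
move=> uv u0.
have [d [h e]] := zero_germ_rep (rep_germ_eq (germ_eq_sym uv) (rep_self v)) u0.
apply: (rep_zero_germ (rep_shift h (rep_self v))) => x.
by rewrite comp_act (e d (dle_refl d)).
Qed.

Definition some_idx (D : dirposet) : D := sval (cid (dp_nonempty D)).

Lemma zero_prohom_subproof P Q (d e : pidx Q) (h : dle d e) :
  germ_eq (germ_post (ptr h)
            (existT _ (some_idx (pidx P)) (zmap _ (Q e)) : germ P (Q e)))
          (existT _ (some_idx (pidx P)) (zmap _ (Q d)) : germ P (Q d)).
Proof.
apply/germ_eqP; exists (some_idx _), (dle_refl _), (dle_refl _) => x /=.
by rewrite comp_act !zmapE raddf0.
Qed.

Definition zero_prohom P Q : prohom P Q :=
  exist _ (fun d => existT _ (some_idx (pidx P)) (zmap _ (Q d)) : germ P (Q d))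
    (@zero_prohom_subproof P Q).

Lemma zero_prohom_zero P Q : pro_zero (zero_prohom P Q).
Proof. by move=> d; exists (some_idx _), (dle_refl _) => x; rewrite zmapE. Qed.
Arguments zero_prohom_zero : clear implicits.

Lemma pro_zero_eq P Q (f g : prohom P Q) :
  prohom_eq f g -> pro_zero f -> pro_zero g.
Proof. by move=> e f0 d; apply: zero_germ_of_eq (e d) (f0 d). Qed.

Lemma pro_zero_uniq P Q (f g : prohom P Q) :
  pro_zero f -> pro_zero g -> prohom_eq f g.
Proof. by move=> f0 g0 d; apply: zero_germ_eq. Qed.

Lemma pro_zero_comp P Q R (g : prohom Q R) (f : prohom P Q) :
  pro_zero f -> pro_zero (procomp g f).
Proof.
move=> f0 d; set n := projT2 (sval g d); have gn := rep_self (sval g d).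
have [c [h e]] := f0 (projT1 (sval g d)).
apply: (rep_zero_germ (rep_comp gn (rep_shift h (rep_self _)))) => x.
by rewrite !comp_act e raddf0.
Qed.

Lemma coker_zero : C -> exists Z : C, forall z : elt Z, z = 0.
Proof.
move=> A; have [Q [q [qs qe]]] := coker_ex (idmor A).
exists Q => z; have [a <-] := qs z.
by apply/qe; exists a; rewrite act_id.
Qed.

(** Zero morphisms are defined by factorization through a zero object; in
pro-objects they are the families of germs that vanish at a large index. *)
Lemma zero_mor_proP P Q (f : @mor (Pro C) P Q) :
  zero_mor f <-> pro_zero f.
Proof.
split=> [[Z [u [v [Z0 e]]]]|f0].
- have [w hw] := (Z0 P).1.
  have u0 : pro_zero u.
    refine (pro_zero_eq (f := zero_prohom P Z) _ (zero_prohom_zero P Z)).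
    change (@heq (Pro C) P Z (zero_prohom P Z) u).
    by rewrite (hw u) (hw (zero_prohom P Z)).
  refine (pro_zero_eq (f := procomp v u) _ (pro_zero_comp v u0)).
  by change (@heq (Pro C) P Q (v \om u) f); symmetry.
have [Z Z0] := coker_zero (P (some_idx (pidx P))).
pose O := pro_const Z; have OP R : (forall u : prohom R O, pro_zero u).
  move=> u d; apply: (rep_zero_germ (rep_self _)) => x; exact: Z0.
have PO R : (forall u : prohom O R, pro_zero u).
  move=> u d; apply: (rep_zero_germ (rep_self _)) => x.
  by rewrite (Z0 x) raddf0.
exists O, (zero_prohom P O), (zero_prohom O Q); split=> [R|].
  split; [exists (zero_prohom R O) | exists (zero_prohom O R)] => v.
  - exact: pro_zero_uniq (OP R v) (OP R _).
  - exact: pro_zero_uniq (PO R v) (PO R _).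
apply: pro_zero_uniq f0 _.
exact: pro_zero_comp (zero_prohom_zero _ _).
Qed.

End ProModule.

(** * An elementwise criterion for exactness of pro-objects *)

Arguments zero_prohom_zero {C} P Q.

Section ProExact.
Variable C : module_category.
Implicit Types P Q R X : proobj C.

(** Injectivity of [i], exactness in the middle and surjectivity of [p], each up
to an increase of the index.  In [ge_mid] the representative [m] of [i] is
arbitrary: its image may shrink when its source index increases, and lifts
are needed at all source indices. *)
Record germwise_exact P Q R (i : prohom P Q) (p : prohom Q R) : Prop :=
  GermwiseExact {
  ge_zero : pro_zero (procomp p i);
  ge_inj : forall a, exists b c (m : mor (P c) (Q b)) (h : dle a c),
    represents (sval i b) m /\ forall x, m @@ x = 0 -> ptr h @@ x = 0;
  ge_mid : forall b c (m : mor (P c) (Q b)), represents (sval i b) m ->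
    exists b' (h : dle b b') e (n : mor (Q b') (R e)),
      represents (sval p e) n /\
      forall y, n @@ y = 0 -> exists x, m @@ x = ptr h @@ y;
  ge_surj : forall e b (n : mor (Q b) (R e)), represents (sval p e) n ->
    exists e' (h : dle e e'), forall z, exists y, n @@ y = ptr h @@ z
}.

Section Exact.
Variables (P Q R : proobj C) (i : prohom P Q) (p : prohom Q R).
Hypothesis ip : germwise_exact i p.

(** Both germs may be moved to one index of [R], and there they agree on the image
of [Q], which contains the image of a larger index of [R]. *)
Lemma ge_cancel (Z : C) (u v : germ R Z) :
  germ_eq (germ_pull u p) (germ_pull v p) -> germ_eq u v.
Proof.
move: u v => [e0 n0] [e1 n1] /= uv.
have [e [h0 h1]] := dp_directed e0 e1.
pose u : germ R Z := existT _ e (n0 \om ptr h0).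
pose v : germ R Z := existT _ e (n1 \om ptr h1).
have eu : germ_eq u (existT _ e0 n0).
  apply/germ_eqP; exists e, (dle_refl e), h0 => x /=.
  by rewrite comp_act tr_id.
have ev : germ_eq v (existT _ e1 n1).
  apply/germ_eqP; exists e, (dle_refl e), h1 => x /=.
  by rewrite comp_act tr_id.
apply: germ_eq_trans (germ_eq_sym eu) _; apply: (germ_eq_trans _ ev).
have : germ_eq (germ_pull u p) (germ_pull v p).
  apply: germ_eq_trans (germ_pull_eq eu (prohom_refl p)) _.
  apply: germ_eq_trans uv _.
  by apply: germ_eq_sym; apply: germ_pull_eq ev (prohom_refl p).
move=> /germ_eqP[c [hc [hc' E]]]; rewrite /= in hc hc' E.
have [e' [k s]] := ge_surj ip (rep_shift hc (rep_self (sval p e))).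
apply/germ_eqP; exists e', k, k => z /=.
have [y <-] := s z.
have := E y; rewrite !comp_act.
have -> : ptr hc' @@ y = ptr hc @@ y.
  by rewrite -(tr_tr (dle_refl _) hc hc') tr_id.
by [].
Qed.

Lemma ge_epi : epi (C := Pro C) p.
Proof. by move=> X g h gh d; apply: ge_cancel (gh d). Qed.

(** A germ on [Q] killed by [i] vanishes on an image of [P], hence on the kernel of
a representative of [p]; it descends along the image of that representative,
which is all of [R] after an increase of the index. *)
Lemma ge_descend (Z : C) (u : germ Q Z) :
  zero_germ (germ_pull u i) ->
  exists v : germ R Z, germ_eq (germ_pull v p) u.
Proof.
move=> u0.
have [c [h0 e]] := u0; set m := projT2 (sval i _) \om ptr h0.
have im : represents (sval i (projT1 u)) m by apply: rep_shift (rep_self _).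
have [b [h [e1 [n [pn nk]]]]] := ge_mid ip im.
have [e2 [k s]] := ge_surj ip pn.
have [z||w hw] := fill1 (f := projT2 u \om ptr h) (h := n) (g := ptr k).
- exact: s.
- move=> y /nk[x ex]; rewrite comp_act -ex.
  by rewrite -[RHS](e x) !comp_act.
exists (existT _ e2 w).
have [c' [n' [bc' pn']]] := rep_above (sval p e2) b.
have [d [bd [cd E]]] := rep_agree pn (rep_tr k pn').
apply: rep_eq (_ : represents _ (w \om n')) (rep_self u) _.
  by apply: germ_post_eq (heq_refl w) pn'.
exists d, cd, (dle_trans h bd) => y.
rewrite comp_act (hw _ (ptr bd @@ y)) ?comp_act ?(tr_tr h bd (dle_trans h bd)) //.
by rewrite (E d (dle_refl d)) comp_act.
Qed.

Lemma ge_cokernel : is_cokernel (C := Pro C) i p.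
Proof.
split; first by apply/zero_mor_proP; apply: ge_zero.
move=> X g /zero_mor_proP gi0.
have ex d : {v : germ R (X d) | germ_eq (germ_pull v p) (sval g d)}.
  by apply: cid; apply: ge_descend (gi0 d).
have cpt d e (h : dle d e) :
    germ_eq (germ_post (ptr h) (sval (ex e))) (sval (ex d)).
  apply: ge_cancel; apply: germ_eq_trans (germ_pull_post _ _ _) _.
  apply: germ_eq_trans (germ_post_eq (heq_refl _) (svalP (ex e))) _.
  apply: germ_eq_trans (svalP g _ _ h) _.
  exact: germ_eq_sym (svalP (ex d)).
pose u : prohom R X := exist _ (fun d => sval (ex d)) cpt.
have up : prohom_eq (procomp u p) g by move=> d; apply: svalP (ex d).
exists u; split=> // v vp; apply: ge_epi.
by move=> d; apply: germ_eq_trans (vp d) (germ_eq_sym (up d)).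
Qed.

Lemma ge_mono : mono (C := Pro C) i.
Proof.
move=> X u v uv a.
have [b [c [m [h [im m0]]]]] := ge_inj ip a.
have [d1 [n1 [_ un]]] := rep_above (sval u c) (some_idx (pidx X)).
have [d2 [n2 [_ vn]]] := rep_above (sval v c) (some_idx (pidx X)).
have [d [h1 [h2 E]]] := rep_agree
  (rep_germ_eq (uv b) (rep_comp im un)) (rep_comp im vn).
apply: rep_eq (rep_tr h un) (rep_tr h vn) _.
exists d, h1, h2 => x; rewrite !comp_act.
apply/eqP; rewrite -subr_eq0 -raddfB; apply/eqP; apply: m0.
by have := E d (dle_refl d) h1 h2 x; rewrite !comp_act raddfB => ->; rewrite subrr.
Qed.

Section Lift.
Variables (X : proobj C) (g : prohom X Q).
Hypothesis pg : pro_zero (procomp p g).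

Lemma ge_pointwise_lift b c (m : mor (P c) (Q b)) :
  represents (sval i b) m ->
  exists d (G : mor (X d) (Q b)),
    represents (sval g b) G /\ forall x, exists y, m @@ y = G @@ x.
Proof.
move=> im; have [b' [h [e [n [pn nk]]]]] := ge_mid ip im.
have [d [G [_ gG]]] := rep_above (sval g b') (some_idx (pidx X)).
have [d' [h' e0]] := zero_germ_rep (rep_comp pn gG) (pg e).
exists d', (ptr h \om G \om ptr h'); split=> [|x].
  exact: rep_shift (rep_tr h gG).
have /nk[y my] : n @@ G @@ ptr h' @@ x = 0.
  by rewrite -(e0 d' (dle_refl d') h' x) comp_act.
by exists y; rewrite my !comp_act.
Qed.

(** A germ [X -> P_a] that is pointwise a preimage of [g] under every representative
of [i].  Quantifying over all representatives makes such a germ unique and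
stable under transition maps, so that the germs chosen for the various [a] are
automatically compatible. *)
Definition lifts a (u : germ X (P a)) :=
  forall b c (m : mor (P c) (Q b)) (h : dle a c), represents (sval i b) m ->
  exists d (G : mor (X d) (Q b)) (u' : mor (X d) (P a)),
    [/\ represents (sval g b) G, represents u u' &
        forall x, exists y, m @@ y = G @@ x /\ u' @@ x = ptr h @@ y].

Lemma lifts_uniq a (u v : germ X (P a)) : lifts u -> lifts v -> germ_eq u v.
Proof.
move=> lu lv; have [b [c [m [h [im m0]]]]] := ge_inj ip a.
have [d [G [u' [gG uu' E]]]] := lu _ _ _ h im.
have [d2 [G2 [v' [gG2 vv' E2]]]] := lv _ _ _ h im.
have [d3 [h1 [h2 EG]]] := rep_agree gG gG2.
apply: rep_eq uu' vv' _; exists d3, h1, h2 => x.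
have [y [my ->]] := E (ptr h1 @@ x); have [y2 [my2 ->]] := E2 (ptr h2 @@ x).
apply/eqP; rewrite -subr_eq0 -raddfB; apply/eqP; apply: m0.
by rewrite raddfB my my2 (EG d3 (dle_refl d3) h1 h2) subrr.
Qed.

(** Where [i] is injective the pointwise lift is a morphism.  It is compared with
another representative of [i] by lifting once more at common larger indices. *)
Lemma lifts_ex a : exists u : germ X (P a), lifts u.
Proof.
have [b0 [c0 [m0 [h0 [im0 k0]]]]] := ge_inj ip a.
have [d0 [G0 [gG0 l0]]] := ge_pointwise_lift im0.
have [u0 hu0] := fill1 (f := ptr h0) l0 k0.
exists (existT _ d0 u0) => b c m h im.
have [b1 [b0b1 bb1]] := dp_directed b0 b.
have [c1' [m1' [_ im1']]] := rep_above (sval i b1) c.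
have [c2 [c1c2 [c0c2 E0]]] := rep_agree (rep_tr b0b1 im1') im0.
have [c3 [c1c3 [cc3 E1]]] := rep_agree (rep_tr bb1 im1') im.
have [c1 [c2c1 c3c1]] := dp_directed c2 c3.
have k1 := dle_trans c1c2 c2c1.
have hc0 := dle_trans c0c2 c2c1; have hc := dle_trans cc3 c3c1.
have [d1 [G1 [gG1 l1]]] := ge_pointwise_lift (rep_shift k1 im1').
have [d2 [d1d2 [d0d2 EG]]] := rep_agree (rep_tr b0b1 gG1) gG0.
exists d2, (ptr bb1 \om G1 \om ptr d1d2), (u0 \om ptr d0d2); split.
- exact: rep_shift (rep_tr bb1 gG1).
- exact: rep_shift (rep_self (existT _ d0 u0 : germ X (P a))).
move=> x; have [y my] := l1 (ptr d1d2 @@ x).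
exists (ptr hc @@ y); split.
  rewrite -(E1 c1 c3c1 k1) comp_act -[m1' @@ ptr k1 @@ y]comp_act my.
  by rewrite !comp_act.
rewrite comp_act (hu0 _ (ptr hc0 @@ y)).
  by rewrite (tr_tr _ _ (dle_trans h0 hc0)) (tr_tr _ _ (dle_trans h0 hc0)).
rewrite -(E0 c1 c2c1 k1) comp_act -[m1' @@ ptr k1 @@ y]comp_act my.
by rewrite -(EG d2 (dle_refl d2) d1d2) comp_act.
Qed.

Lemma lifts_tr a a' (h : dle a a') (u : germ X (P a')) :
  lifts u -> lifts (germ_post (ptr h) u).
Proof.
move=> lu b c m hc im; have [c1 [cc1 a'c1]] := dp_directed c a'.
have [d [G [u' [gG uu' E]]]] := lu _ _ _ a'c1 (rep_shift cc1 im).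
exists d, G, (ptr h \om u'); split=> // [|x].
  exact: germ_post_eq (heq_refl (ptr h)) uu'.
have [y [my uy]] := E x; exists (ptr cc1 @@ y); rewrite -my !comp_act uy.
by rewrite (tr_tr _ _ (dle_trans h a'c1)) (tr_tr _ _ (dle_trans h a'c1)).
Qed.

Lemma ge_lift : exists u : prohom X P, prohom_eq (procomp i u) g.
Proof.
have ex a := cid (lifts_ex a).
have cpt d e (h : dle d e) :
    germ_eq (germ_post (ptr h) (sval (ex e))) (sval (ex d)).
  by apply: lifts_uniq (svalP (ex d)); apply: lifts_tr (svalP (ex e)).
pose u : prohom X P := exist _ (fun d => sval (ex d)) cpt.
exists u => b; have im := rep_self (sval i b).
have [d [G [u' [gG uu' E]]]] := svalP (ex _) _ _ _ (dle_refl _) im.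
apply: rep_eq (rep_comp im (uu' : represents (sval u _) u')) gG _.
exists d, (dle_refl d), (dle_refl d) => x; rewrite !tr_id comp_act.
by have [y [<- ->]] := E x; rewrite tr_id.
Qed.

End Lift.

Lemma ge_kernel : is_kernel (C := Pro C) i p.
Proof.
split; first by apply/zero_mor_proP; apply: ge_zero.
move=> X g /zero_mor_proP pg; have [u iu] := ge_lift pg.
exists u; split=> // v iv; apply: ge_mono.
by move=> d; apply: germ_eq_trans (iv d) (germ_eq_sym (iu d)).
Qed.

Lemma ge_exact : abelian_exact (C := Pro C) i p.
Proof. by split; [apply: ge_kernel | apply: ge_cokernel]. Qed.

End Exact.

End ProExact.

(** * Pullback of a pro-epimorphism along a constant pro-object *)

Section ProPullback.
Variables (C : module_category) (P Q R : proobj C).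
Variables (i : prohom P Q) (p : prohom Q R).
Hypothesis ip : germwise_exact i p.
Variables (K : C) (f : forall W, mor K (R W)).
Hypothesis fc : is_cone f.

Lemma cone_tr W W' (h : dle W W') x : ptr h @@ f W' @@ x = f W @@ x.
Proof. by rewrite -comp_act; move: x; apply/heqP; apply: fc. Qed.

(** An index carries a representative of a component of [p]; the pullback at that
index is an ordinary pullback of modules. *)
Record pull_idx := PullIdx {
  pq : pidx Q;
  pr : pidx R;
  pull_le : dle (projT1 (sval p pr)) pq
}.

Definition pull_map (x : pull_idx) : mor (Q (pq x)) (R (pr x)) :=
  projT2 (sval p (pr x)) \om ptr (pull_le x).

Lemma pull_map_rep x : represents (sval p (pr x)) (pull_map x).
Proof. exact: rep_shift (rep_self _). Qed.

(** Representatives of [p] at different indices are compatible only after an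
increase of the index in [Q]; the order records when this has happened. *)
Definition pidx_le (x y : pull_idx) :=
  [/\ dle (pq x) (pq y), dle (pr x) (pr y) &
      forall (hq : dle (pq x) (pq y)) (hr : dle (pr x) (pr y)) t,
        ptr hr @@ pull_map y @@ t = pull_map x @@ ptr hq @@ t].

Lemma pidx_le_refl x : pidx_le x x.
Proof. by split=> [||hq hr t]; rewrite ?tr_id //; apply: dle_refl. Qed.

Lemma pidx_le_trans x y z : pidx_le x y -> pidx_le y z -> pidx_le x z.
Proof.
move=> [xy1 xy2 e] [yz1 yz2 e']; split=> [||hq hr t].
- exact: dle_trans yz1.
- exact: dle_trans yz2.
by rewrite -(tr_tr xy2 yz2) -(tr_tr xy1 yz1) -e -e'.
Qed.

Lemma pidx_le_anti x y : pidx_le x y -> pidx_le y x -> x = y.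
Proof.
case: x y => [a b h] [a' b' h'] [/= l1 l2 _] [/= l3 l4 _].
have ea := dle_anti l1 l3; have eb := dle_anti l2 l4.
by case: _ / ea h' {l1 l3} => h'; case: _ / eb h' {l2 l4} => h';
  congr PullIdx; apply: Prop_irrelevance.
Qed.

Lemma pull_idx_above U W : exists x, dle U (pq x) /\ dle W (pr x).
Proof.
have [U' [h1 h2]] := dp_directed U (projT1 (sval p W)).
by exists (PullIdx h2); split=> //; apply: dle_refl.
Qed.

Lemma pull_idx_directed x y : exists z, pidx_le x z /\ pidx_le y z.
Proof.
have [W [xW yW]] := dp_directed (pr x) (pr y).
have pW := rep_self (sval p W).
have [d1 [h1 [h1' E1]]] := rep_agree (rep_tr xW pW) (pull_map_rep x).
have [d2 [h2 [h2' E2]]] := rep_agree (rep_tr yW pW) (pull_map_rep y).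
have [U [k1 k2]] := dp_directed d1 d2.
exists (PullIdx (dle_trans h1 k1)).
split; split=> //=; try exact: dle_trans k1; try exact: dle_trans k2.
- move=> hq hr t.
  have := E1 U k1 (dle_trans h1 k1) hq t.
  rewrite /pull_map /= !comp_act => <-.
  by congr (act (ptr _) _); apply: Prop_irrelevance.
- move=> hq hr t.
  have := E2 U k2 (dle_trans h1 k1) hq t.
  rewrite /pull_map /= !comp_act => <-.
  by congr (act (ptr _) _); apply: Prop_irrelevance.
Qed.

Definition pull_dirposet : dirposet :=
  DirPoset pidx_le_refl pidx_le_trans pidx_le_anti
    (let: ex_intro x _ := pull_idx_above (some_idx _) (some_idx _) in
     ex_intro _ x I)
    pull_idx_directed.

Definition pull_term (x : pull_idx) : C := pb (pull_map x) (f (pr x)).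

Notation pq1 x := (pb1 (pull_map x) (f (pr x))).
Notation pq2 x := (pb2 (pull_map x) (f (pr x))).

Lemma pull_tr_ex x y : pidx_le x y -> exists u : mor (pull_term y) (pull_term x),
  forall (h : dle (pq x) (pq y)) t,
    pq1 x @@ u @@ t = ptr h @@ pq1 y @@ t /\ pq2 x @@ u @@ t = pq2 y @@ t.
Proof.
move=> [h k e].
have [t|u hu] := @pb_lift C (pull_term y) _ _ _ (pull_map x) (f (pr x))
    (ptr h \om pq1 y) (pq2 y).
  by rewrite [(ptr h \om _) @@ _]comp_act -(e h k) pb_comm cone_tr.
exists u => h' t; have [-> ->] := hu t; rewrite comp_act.
by split=> //; congr (act (ptr _) _); apply: Prop_irrelevance.
Qed.

Definition pull_tr x y (h : pidx_le x y) : mor (pull_term y) (pull_term x) :=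
  sval (cid (pull_tr_ex h)).

Lemma pull_tr1 x y (h : pidx_le x y) (k : dle (pq x) (pq y)) t :
  pq1 x @@ pull_tr h @@ t = ptr k @@ pq1 y @@ t.
Proof. by rewrite /pull_tr; case: cid => u /= /(_ k t)[]. Qed.

Lemma pull_tr2 x y (h : pidx_le x y) t : pq2 x @@ pull_tr h @@ t = pq2 y @@ t.
Proof. by rewrite /pull_tr; case: cid => u /=; case: h => k _ _ /(_ k t)[]. Qed.

Lemma pull_tr_id x (h : pidx_le x x) : pull_tr h =m idmor (pull_term x).
Proof.
apply/heqP => t; rewrite act_id; apply: pb_eq.
- by rewrite (pull_tr1 h (dle_refl _)) tr_id.
- by rewrite pull_tr2.
Qed.

Lemma pull_tr_comp x y z (h : pidx_le x y) (h' : pidx_le y z) (k : pidx_le x z) :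
  pull_tr h \om pull_tr h' =m pull_tr k.
Proof.
apply/heqP => t; rewrite comp_act; have [a _ _] := h; have [b _ _] := h'.
apply: pb_eq; last by rewrite !pull_tr2.
rewrite (pull_tr1 h a) (pull_tr1 h' b) (pull_tr1 k (dle_trans a b)).
by rewrite (tr_tr _ _ (dle_trans a b)).
Qed.

Definition pro_pullback : proobj C :=
  @ProObj C pull_dirposet pull_term pull_tr pull_tr_id pull_tr_comp.

Lemma pull_ptrE x y (h : pidx_le x y) : @ptr C pro_pullback x y h = pull_tr h.
Proof. by []. Qed.

Lemma pull_fst_ex U : exists x, dle U (pq x).
Proof. by have [x [Ux _]] := pull_idx_above U (some_idx _); exists x. Qed.

Definition pull_fst_germ U : germ pro_pullback (Q U) :=
  let x := cid (pull_fst_ex U) in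
  existT (fun x : pull_idx => mor (pull_term x) (Q U)) (sval x)
    (ptr (svalP x) \om pq1 (sval x)).

Lemma pull_fst_rep U x (h : dle U (pq x)) :
  represents (P := pro_pullback) (c := x) (pull_fst_germ U) (ptr h \om pq1 x).
Proof.
rewrite /pull_fst_germ; case: cid => y hy /=.
have [z [xz yz]] := pull_idx_directed x y.
apply/germ_eqP; exists z, xz, yz => t /=; rewrite !comp_act.
have [a _ _] := xz; have [b _ _] := yz.
rewrite ?pull_ptrE (pull_tr1 xz a) (pull_tr1 yz b).
by rewrite (tr_tr _ _ (dle_trans h a)) (tr_tr _ _ (dle_trans h a)).
Qed.

Lemma pull_fst_subproof U V (h : dle U V) :
  germ_eq (germ_post (ptr h) (pull_fst_germ V)) (pull_fst_germ U).
Proof.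
have [x Vx] := pull_fst_ex V.
apply: germ_eq_trans (pull_fst_rep (dle_trans h Vx)).
apply: germ_eq_trans (germ_post_eq (heq_refl _) (germ_eq_sym (pull_fst_rep Vx))) _.
apply/germ_eqP; exists x, (pidx_le_refl x), (pidx_le_refl x) => t /=.
by rewrite !comp_act (tr_tr _ _ (dle_trans h Vx)).
Qed.

Definition pull_fst : prohom pro_pullback Q := exist _ _ pull_fst_subproof.

Definition pull_snd_germ (_ : unit) : germ pro_pullback K :=
  existT (fun x : pull_idx => mor (pull_term x) K) (some_idx pull_dirposet)
    (pq2 (some_idx pull_dirposet)).

Lemma pull_snd_rep e x :
  represents (P := pro_pullback) (c := x) (pull_snd_germ e) (pq2 x).
Proof.
have [z [xz yz]] := pull_idx_directed x (some_idx pull_dirposet).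
apply/germ_eqP; exists z, xz, yz => t /=.
by rewrite ?pull_ptrE !pull_tr2.
Qed.

Lemma pull_snd_subproof (d e : pidx (pro_const K)) (h : dle d e) :
  germ_eq (germ_post (@ptr C (pro_const K) d e h) (pull_snd_germ e))
    (pull_snd_germ d).
Proof. exact: germ_post_id. Qed.

Definition pull_snd : prohom pro_pullback (pro_const K) :=
  exist _ (pull_snd_germ : forall d : pidx (pro_const K), germ _ (pro_const K d))
    pull_snd_subproof.

Lemma pull_square :
  prohom_eq (procomp p pull_fst) (procomp (cone_mor fc) pull_snd).
Proof.
move=> W; have [x [_ Wx]] := pull_idx_above (some_idx _) W.
pose L := rep_comp (rep_tr Wx (pull_map_rep x))
  (pull_fst_rep (dle_refl (pq x)) : represents (sval pull_fst _) _).
pose M := rep_comp (rep_self (sval (cone_mor fc) W))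
  (pull_snd_rep tt x : represents (sval pull_snd tt) _).
apply: rep_eq L M _; exists x, (pidx_le_refl x), (pidx_le_refl x) => t.
rewrite /= !comp_act tr_id -[_ @@ ptr (pull_le x) @@ _]comp_act -/(pull_map x).
by rewrite pb_comm cone_tr.
Qed.

(** The germ at [x] of the morphism to the pullback induced by [i] and [0]. *)
Definition pull_lifts x (u : germ P (pull_term x)) :=
  exists c (v : mor (P c) (pull_term x)) (m : mor (P c) (Q (pq x))),
    [/\ represents u v, represents (sval i (pq x)) m &
        forall t, pq1 x @@ v @@ t = m @@ t /\ pq2 x @@ v @@ t = 0].

Lemma pull_lifts_ex x : exists u, pull_lifts (x := x) u.
Proof.
have im := rep_self (sval i (pq x)).
have [d [h e]] := zero_germ_rep (rep_comp (pull_map_rep x) im) (ge_zero ip (pr x)).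
have [t|v hv] := @pb_lift C (P d) _ _ _ (pull_map x) (f (pr x))
    (projT2 (sval i (pq x)) \om ptr h) (zmap (P d) K).
  by rewrite zmapE raddf0 -(e d (dle_refl d) h t) !comp_act.
exists (existT _ d v), d, v, (projT2 (sval i (pq x)) \om ptr h); split.
- exact: rep_self (existT _ d v : germ P _).
- exact: rep_shift im.
by move=> t; have [-> ->] := hv t; rewrite zmapE.
Qed.

Lemma pull_lifts_compat x y (h : pidx_le x y) u v :
  pull_lifts (x := x) u -> pull_lifts (x := y) v ->
  germ_eq (germ_post (pull_tr h) v) u.
Proof.
move=> [c [u' [m [uu' im E]]]] [d [v' [n [vv' jn E']]]].
have [hq _ _] := h.
have [e [ce [de A]]] := rep_agree im (rep_tr hq jn).
apply: rep_eq (_ : represents _ (pull_tr h \om v')) uu' _.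
  exact: germ_post_eq (heq_refl _) vv'.
exists e, de, ce => t; rewrite comp_act; apply: pb_eq.
  rewrite (pull_tr1 h hq) (E _).1 (E' _).1 (A e (dle_refl e) ce de).
  by rewrite comp_act.
by rewrite pull_tr2 (E _).2 (E' _).2.
Qed.

Definition pull_incl_germ (x : pidx pro_pullback) : germ P (pro_pullback x) :=
  sval (cid (pull_lifts_ex x)).

Lemma pull_incl_subproof (x y : pidx pro_pullback) (h : dle x y) :
  germ_eq (germ_post (ptr h) (pull_incl_germ y)) (pull_incl_germ x).
Proof.
exact: (pull_lifts_compat h (svalP (cid (pull_lifts_ex x)))
                            (svalP (cid (pull_lifts_ex y)))).
Qed.

Definition pull_incl : prohom P pro_pullback := exist _ _ pull_incl_subproof.

Lemma pull_incl_lifts x : pull_lifts (x := x) (sval pull_incl x).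
Proof. exact: svalP (cid (pull_lifts_ex x)). Qed.

(** Each condition is that of [i] and [p], read in the first coordinate; surjectivity
onto [K] holds since [p] reaches the values of [f] at a large index. *)
Lemma pull_exact : germwise_exact pull_incl pull_snd.
Proof.
split.
- case; pose x := some_idx pull_dirposet.
  have [c [v [m [uv im E]]]] := pull_incl_lifts x.
  have L := rep_comp (pull_snd_rep tt x : represents (sval pull_snd tt) _) uv.
  apply: (rep_zero_germ L) => t.
  by rewrite comp_act (E t).2.
- move=> a; have [b [c [m [h [im m0]]]]] := ge_inj ip a.
  have [x bx] := pull_fst_ex b.
  have [d [v [n [uv jn E]]]] := pull_incl_lifts x.
  have [e [de [ce A]]] := rep_agree (rep_tr bx jn) im.
  exists x, e, (v \om ptr de), (dle_trans h ce); split=> [|t].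
    exact: rep_shift uv.
  rewrite comp_act -(tr_tr h ce) => v0; apply: m0.
  by rewrite -(A e (dle_refl e) de) comp_act -(E _).1 v0 !raddf0.
- move=> x c m um.
  have [d [v [n [uv jn E]]]] := pull_incl_lifts x.
  have [c1 [cc1 [dc1 A]]] := rep_agree um uv.
  have [U [xU [e [w [pw wk]]]]] := ge_mid ip (rep_shift dc1 jn).
  have [y0 [Uy0 ey0]] := pull_idx_above U e.
  have [y1 [xy1 y0y1]] := pull_idx_directed x y0.
  have [hU he _] := y0y1; have Uy := dle_trans Uy0 hU; have ey := dle_trans ey0 he.
  (* Past [g] the representative [w] agrees with the map used in the pullback. *)
  have [g [y1g [Ug B]]] := rep_agree (rep_tr ey (pull_map_rep y1)) pw.
  have [y2 [gy2 _]] := pull_idx_above g (some_idx _).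
  have [y [y2y y1y]] := pull_idx_directed y2 y1.
  have xy := pidx_le_trans xy1 y1y.
  exists y, xy, tt, (pq2 y); split=> [|t t0].
    exact: pull_snd_rep.
  have [hq _ _] := xy; have [k1 k2 k3] := y1y; have [l1 _ _] := y2y.
  have gy := dle_trans gy2 l1; have Uy' := dle_trans Ug gy.
  have : w @@ ptr Uy' @@ pq1 y @@ t = 0.
    rewrite -(B _ gy k1) comp_act -(k3 k1 k2) pb_comm t0 !raddf0.
    by [].
  move=> /wk[s es]; exists (ptr cc1 @@ s).
  rewrite (A c1 (dle_refl c1) cc1 dc1); apply: pb_eq.
    rewrite (E _).1 (pull_tr1 xy hq) -comp_act es.
    by rewrite (tr_tr xU Uy' hq).
  by rewrite (E _).2 pull_tr2 t0.
move=> [] x n pn.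
have [y [xy [_ A]]] := rep_agree pn (pull_snd_rep tt x).
have [W [h s]] := ge_surj ip (pull_map_rep y).
exists tt, I => z; have [q eq] := s (f W @@ z).
have [t [t1 t2]] := pb_elt (etrans eq (cone_tr h z)).
exists (pull_tr xy @@ t).
rewrite [LHS](A y (pidx_le_refl y) xy xy) /= pull_tr2 t2.
by rewrite act_id.
Qed.

End ProPullback.

(** * Kernels, cokernels and fully faithful functors *)

Section Categories.
Variable C : category.

Lemma zero_mor_postcomp (X Y Z : C) (g : mor Y Z) (f : mor X Y) :
  zero_mor f -> zero_mor (g \om f).
Proof.
move=> [O [u [v [O0 e]]]]; exists O, u, (g \om v); split=> //.
by rewrite e mcompA.
Qed.

Lemma zero_mor_heq (A B : C) (f g : mor A B) :
  f =m g -> zero_mor f -> zero_mor g.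
Proof.
by move=> e [O [u [v [O0 e']]]]; exists O, u, v; split=> //; rewrite -e.
Qed.

Lemma cokernel_epi (A B D : C) (i : mor A B) (p : mor B D) :
  is_cokernel i p -> epi p.
Proof.
move=> [pi0 univ] X g h gh.
have gpi0 : zero_mor ((g \om p) \om i).
  by apply: zero_mor_heq (zero_mor_postcomp g pi0); rewrite mcompA.
have [u [_ uniq]] := univ X _ gpi0.
by rewrite (uniq g) // (uniq h) //; symmetry.
Qed.

Lemma kernel_mono (A B D : C) (i : mor A B) (p : mor B D) :
  is_kernel i p -> mono i.
Proof.
move=> [pi0 univ] X g h gh.
have pig0 : zero_mor (p \om (i \om g)).
  move: pi0 => [O [u [v [O0 e]]]]; exists O, (u \om g), v; split=> //.
  by rewrite mcompA e mcompA.
have [u [_ uniq]] := univ X _ pig0.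
by rewrite (uniq g) // (uniq h) //; symmetry.
Qed.

End Categories.

Section Reflection.
Variables (C D : category) (F : functor C D).
Hypothesis full : forall (A B : C) (g : mor (F A) (F B)),
  exists f : mor A B, func_mor F f =m g.
Hypothesis faithful : forall (A B : C) (f g : mor A B),
  func_mor F f =m func_mor F g -> f =m g.
Hypothesis zeroF : forall (A B : C) (f : mor A B),
  zero_mor (func_mor F f) <-> zero_mor f.

Lemma reflect_exact (A B E : C) (i : mor A B) (p : mor B E) :
  Ex1 (func_mor F i) (func_mor F p) -> Ex1 i p.
Proof.
move=> [[pi0 ker] [_ cok]].
have pi : zero_mor (p \om i).
  by apply/zeroF; apply: zero_mor_heq pi0; symmetry; apply: func_morM.
split; split=> // X g.
- move=> pg; have [|u [iu uniq]] := ker (F X) (func_mor F g).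
    by apply: zero_mor_heq (func_morM F p g) _; apply/zeroF.
  have [u' eu] := full u; exists u'; split=> [|v iv].
    by apply: faithful; rewrite func_morM eu.
  apply: faithful; rewrite eu; apply: uniq; rewrite -func_morM.
  exact: func_mor_heq.
- move=> gi; have [|u [up uniq]] := cok (F X) (func_mor F g).
    by apply: zero_mor_heq (func_morM F g i) _; apply/zeroF.
  have [u' eu] := full u; exists u'; split=> [|v vp].
    by apply: faithful; rewrite func_morM eu.
  apply: faithful; rewrite eu; apply: uniq; rewrite -func_morM.
  exact: func_mor_heq.
Qed.

End Reflection.

(** * Categories of complete separated linear topologies *)

(** Maps [r_j] whose kernels form a base of neighbourhoods of zero for a
complete separated topology.  Completeness speaks of Cauchy families indexed by
the base itself. *)
Record complete_filtration (V : zmodType) (J : Type) (W : J -> zmodType)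
    (r : forall j, V -> W j) : Prop := CompleteFiltration {
  filt_nonempty : exists j : J, True;
  filt_directed : forall j j', exists l, forall v,
    r l v = 0 -> r j v = 0 /\ r j' v = 0;
  filt_separated : forall v, (forall j, r j v = 0) -> v = 0;
  filt_complete : forall x : J -> V,
    (forall j l, (forall v, r l v = 0 -> r j v = 0) ->
       r j (x l) = r j (x j)) ->
    exists v, forall j, r j v = r j (x j)
}.

(** The common features of complete separated topological groups and of
topological vector spaces: [und] forgets the topology, [oproj U] is the
projection to the quotient by the open submodule [U], and [tc_build] equips a
module with the topology defined by a complete filtration, up to the
isomorphism [phi]. *)
Record topological_category (C : module_category) := TopologicalCategory {
  tc_cat :> category;
  tc_pro : functor tc_cat (Pro C);
  und : tc_cat -> C;
  under : forall A B : tc_cat, mor A B -> mor (und A) (und B);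
  under_heq : forall (A B : tc_cat) (f g : mor A B),
    f =m g <-> under f =m under g;
  under_id : forall A : tc_cat, under (idmor A) =m idmor (und A);
  under_comp : forall (X Y Z : tc_cat) (g : mor Y Z) (f : mor X Y),
    under (g \om f) =m under g \om under f;
  oproj : forall (A : tc_cat) (U : pidx (tc_pro A)),
    mor (und A) (pterm (tc_pro A : proobj C) U);
  oproj_cone : forall A : tc_cat,
    is_cone (P := (tc_pro A : proobj C)) (@oproj A);
  oproj_surj : forall (A : tc_cat) (U : pidx (tc_pro A)) z,
    exists a, oproj U @@ a = z;
  oproj_sep : forall (A : tc_cat) a,
    (forall U : pidx (tc_pro A), oproj U @@ a = 0) -> a = 0;
  oproj_complete : forall (A : tc_cat)
    (x : forall U : pidx (tc_pro A), elt (pterm (tc_pro A : proobj C) U)),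
    (forall U V (h : dle U V), ptr h @@ x V = x U) ->
    exists a, forall U, oproj U @@ a = x U;
  oproj_nat : forall (A B : tc_cat) (f : mor A B) (V : pidx (tc_pro B)) a,
    projT2 (sval (func_mor tc_pro f : prohom _ _) V) @@ oproj _ @@ a =
    oproj V @@ under f @@ a;
  tc_lift : forall (A B : tc_cat) (g : mor (und A) (und B)),
    (forall V : pidx (tc_pro B), exists U : pidx (tc_pro A), forall a,
       oproj U @@ a = 0 -> oproj V @@ g @@ a = 0) ->
    exists f : mor A B, under f =m g;
  tc_build : forall (V : C) (J : Type) (W : J -> C)
    (r : forall j, mor V (W j)),
    complete_filtration (fun j => act (r j)) ->
    exists (A : tc_cat) (phi : mor (und A) V) (psi : mor V (und A)),
      [/\ forall a, psi @@ phi @@ a = a, forall v, phi @@ psi @@ v = v,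
          forall j, exists U : pidx (tc_pro A), forall a,
            oproj U @@ a = 0 -> r j @@ phi @@ a = 0 &
          forall U : pidx (tc_pro A), exists j, forall a,
            r j @@ phi @@ a = 0 -> oproj U @@ a = 0]
}.

Arguments tc_pro {C} t.
Arguments und {C t} A.
Arguments oproj {C t A} U.

Section TopologicalCategory.
Variables (C : module_category) (T : topological_category C).

Notation F := (tc_pro T).
Notation pro A := (func_obj F A : proobj C).
Notation profun f := (func_mor F f : prohom _ _).
Notation "f @- x" := (under f @@ x) (at level 35, right associativity).

Lemma oproj_tr (A : T) (U V : pidx (pro A)) (h : dle U V) a :
  ptr h @@ oproj V @@ a = oproj U @@ a.
Proof. by rewrite -comp_act; move: a; apply/heqP; apply: oproj_cone. Qed.

Lemma oproj_inj (A : T) (a b : elt (und A)) :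
  (forall U : pidx (pro A), oproj U @@ a = oproj U @@ b) -> a = b.
Proof.
move=> e; apply/eqP; rewrite -subr_eq0; apply/eqP; apply: oproj_sep => U.
by rewrite raddfB e subrr.
Qed.

Lemma rep_val (A : T) (Z : C) (u : germ (pro A) Z) c (m : mor (pro A c) Z) d
    (n : mor (pro A d) Z) a :
  represents u m -> represents u n ->
  m @@ oproj c @@ a = n @@ oproj d @@ a.
Proof.
move=> um un; have [e [h [h' E]]] := rep_agree um un.
by have := E e (dle_refl e) h h' (oproj e @@ a); rewrite !oproj_tr.
Qed.

Lemma rep_val_eq (A : T) (Z : C) (u v : germ (pro A) Z)
    c (m : mor (pro A c) Z) d (n : mor (pro A d) Z) :
  represents u m -> represents v n ->
  (forall a, m @@ oproj c @@ a = n @@ oproj d @@ a) -> germ_eq u v.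
Proof.
move=> um vn E; have [e [h h']] := dp_directed c d.
apply: rep_eq um vn _; exists e, h, h' => x.
by have [a <-] := oproj_surj x; rewrite !oproj_tr.
Qed.

Lemma zero_germ_val (A : T) (Z : C) (u : germ (pro A) Z) c (m : mor (pro A c) Z) :
  represents u m -> (zero_germ u <-> forall a, m @@ oproj c @@ a = 0).
Proof.
move=> um; split=> [u0 a|E].
  have [d [h e]] := zero_germ_rep um u0.
  by have := e d (dle_refl d) h (oproj d @@ a); rewrite oproj_tr.
by apply: rep_zero_germ um _ => x; have [a <-] := oproj_surj x.
Qed.

Lemma rep_nat (A B : T) (f : mor A B) (V : pidx (pro B)) (U : pidx (pro A))
    (m : mor (pro A U) (pro B V)) a :
  represents (sval (profun f) V) m -> m @@ oproj U @@ a = oproj V @@ f @- a.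
Proof. by move=> fm; rewrite -oproj_nat; apply: rep_val fm (rep_self _). Qed.

Lemma under_act (A B : T) (f g : mor A B) :
  f =m g <-> forall a, f @- a = g @- a.
Proof. by split=> [/under_heq/heqP|e]; [|apply/under_heq/heqP]. Qed.

Lemma under_comp_act (X Y Z : T) (g : mor Y Z) (f : mor X Y) a :
  (g \om f) @- a = g @- f @- a.
Proof. by rewrite -comp_act; move: a; apply/heqP; apply: under_comp. Qed.

Lemma continuous_at (A B : T) (f : mor A B) (V : pidx (pro B)) :
  exists U : pidx (pro A), forall a, oproj U @@ a = 0 -> oproj V @@ f @- a = 0.
Proof.
by exists (projT1 (sval (profun f) V)) => a a0; rewrite -oproj_nat a0 raddf0.
Qed.

Lemma tc_pro_faithful (A B : T) (f g : mor A B) :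
  func_mor F f =m func_mor F g -> f =m g.
Proof.
move=> e; apply/under_act => a; apply: oproj_inj => V.
have fm := rep_self (sval (profun f) V).
by rewrite -(rep_nat _ fm); apply: rep_nat (rep_germ_eq (e V) fm).
Qed.

(** A complete separated module is the limit of its discrete quotients. *)
Lemma cone_lift (A : T) (X : C) (x : forall U : pidx (pro A), mor X (pro A U)) :
  is_cone x -> exists u : mor X (und A), forall U t, oproj U @@ u @@ t = x U @@ t.
Proof.
move=> xc.
have E t : exists a, forall U : pidx (pro A), oproj U @@ a = x U @@ t.
  apply: oproj_complete => U V h.
  by rewrite -comp_act; move: t; apply/heqP; apply: xc.
have [||u hu] := @fill C X (und A) (und A) (pidx (pro A)) _ (idmor _) oproj x.
- exact: E.
- by move=> a a0; rewrite act_id; apply: oproj_sep.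
by exists u => U t; have [a ea] := E t; rewrite (hu t a ea) act_id.
Qed.

Lemma tc_pro_full (A B : T) (g : mor (F A) (F B)) :
  exists f : mor A B, func_mor F f =m g.
Proof.
pose x V : mor (und A) (pro B V) :=
  projT2 (sval (g : prohom _ _) V) \om oproj (projT1 (sval (g : prohom _ _) V)).
have [|u hu] := @cone_lift B _ x.
  move=> V V' h; apply/heqP => a; rewrite !comp_act -comp_act.
  have gV := rep_self (sval (g : prohom _ _) V).
  have gV' := rep_self (sval (g : prohom _ _) V').
  exact: rep_val (rep_tr h gV') gV.
have [V|f hf] := @tc_lift C T A B u.
  exists (projT1 (sval (g : prohom _ _) V)) => a a0.
  by rewrite hu comp_act a0 raddf0.
exists f => V; apply: rep_val_eq (rep_self _) (rep_self _) _ => a.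
by rewrite oproj_nat; have /heqP-> := hf; rewrite hu comp_act.
Qed.

Lemma discrete_object (Q : C) :
  exists (X : T) (phi : mor (und X) Q) (psi : mor Q (und X)) (V : pidx (pro X)),
    [/\ forall a, psi @@ phi @@ a = a, forall v, phi @@ psi @@ v = v &
        forall a, oproj V @@ a = 0 -> a = 0].
Proof.
have [|X [phi [psi [pK Kp c1 c2]]]] :=
  @tc_build C T Q unit (fun=> Q) (fun=> idmor Q).
  split=> [|[] []|v /(_ tt)|x _]; try by exists tt.
    by rewrite act_id.
  by exists (x tt) => -[].
have [V hV] := c1 tt; exists X, phi, psi, V; split=> // a /hV.
by rewrite act_id => a0; rewrite -[a]pK a0 raddf0.
Qed.

Lemma zero_object_ex : T -> exists O : T, forall a : elt (und O), a = 0.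
Proof.
move=> A; have [Z Z0] := coker_zero (und A).
have [O [phi [psi [V [pK _ _]]]]] := discrete_object Z.
by exists O => a; rewrite -[a]pK [phi @@ a]Z0 raddf0.
Qed.

Lemma zero_map_ex (A B : T) : exists f : mor A B, forall a, f @- a = 0.
Proof.
have [V|f hf] := @tc_lift C T A B (zmap _ _).
  by exists (some_idx _) => a _; rewrite zmapE raddf0.
by exists f => a; have /heqP-> := hf; rewrite zmapE.
Qed.

Lemma zero_mor_topP (A B : T) (f : mor A B) : zero_mor f <-> forall a, f @- a = 0.
Proof.
split=> [[Z [u [v [Z0 e]]]] a|f0].
  have [w hw] := (Z0 A).1; have [z z0] := zero_map_ex A Z.
  move/under_act: e => ->; rewrite under_comp_act.
  have /under_act-> : u =m z by rewrite (hw u) (hw z).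
  by rewrite z0 raddf0.
have [O O0] := zero_object_ex A.
have [u u0] := zero_map_ex A O; have [v v0] := zero_map_ex O B.
exists O, u, v; split=> [X|].
  have [x x0] := zero_map_ex X O; have [y y0] := zero_map_ex O X.
  split; [exists x | exists y] => w; apply/under_act => a.
    by rewrite x0; apply: O0.
  by rewrite y0 (O0 a) raddf0.
by apply/under_act => a; rewrite under_comp_act v0 f0.
Qed.

Lemma pro_zero_topP (A B : T) (f : mor A B) :
  pro_zero (profun f) <-> forall a, f @- a = 0.
Proof.
split=> [f0 a|f0 V].
  apply: oproj_sep => V; rewrite -oproj_nat.
  by move: a; apply/(zero_germ_val (rep_self _)).
by apply/(zero_germ_val (rep_self _)) => a; rewrite oproj_nat f0 raddf0.
Qed.

Lemma tc_pro_zero (A B : T) (f : mor A B) :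
  zero_mor (func_mor F f) <-> zero_mor f.
Proof.
apply: (iff_trans (zero_mor_proP _)).
by apply: (iff_trans (pro_zero_topP f)); apply: iff_sym; apply: zero_mor_topP.
Qed.

(** The topology of [A'] is induced by [i], that of [A/i(A')] is induced by [p], and
the image of [p] is dense.  Injectivity of [i] and exactness at [A] follow, since
[A'] is separated and complete. *)
Record strictly_exact (A' A A'' : T) (i : mor A' A) (p : mor A A'') : Prop :=
  StrictlyExact {
  se_zero : forall a, p @- i @- a = 0;
  se_inj : forall U' : pidx (pro A'), exists U : pidx (pro A), forall a,
    oproj U @@ i @- a = 0 -> oproj U' @@ a = 0;
  se_mid : forall U : pidx (pro A), exists W : pidx (pro A''), forall a,
    oproj W @@ p @- a = 0 -> exists a', oproj U @@ i @- a' = oproj U @@ a;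
  se_surj : forall (W : pidx (pro A'')) z, exists a,
    oproj W @@ p @- a = oproj W @@ z
}.

Lemma strictly_germwise (A' A A'' : T) (i : mor A' A) (p : mor A A'') :
  strictly_exact i p -> germwise_exact (profun i) (profun p).
Proof.
move=> ip; split.
- apply: (pro_zero_eq (func_morM F p i : prohom_eq _ _)).
  by apply/pro_zero_topP => a; rewrite under_comp_act (se_zero ip).
- move=> U'; have [U hU] := se_inj ip U'.
  have [c [m [h im]]] := rep_above (sval (profun i) U) U'.
  exists U, c, m, h; split=> // x.
  have [a <-] := oproj_surj x; rewrite (rep_nat _ im) oproj_tr.
  exact: hU.
- move=> U c m im; have [W hW] := se_mid ip U.
  have [V [n [h pn]]] := rep_above (sval (profun p) W) U.
  exists V, h, W, n; split=> // y.
  have [a <-] := oproj_surj y; rewrite (rep_nat _ pn) oproj_tr => /hW[a' e].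
  by exists (oproj c @@ a'); rewrite (rep_nat _ im).
move=> W b n pn; exists W, (dle_refl W) => z.
have [a'' <-] := oproj_surj z; have [a e] := se_surj ip W a''.
by exists (oproj b @@ a); rewrite (rep_nat _ pn) tr_id.
Qed.

(** The kernel is closed, so it is complete in the induced topology. *)
Lemma kernel_object (A B : T) (p : mor A B) :
  exists (K : T) (k : mor K A),
    [/\ forall x, k @- x = 0 -> x = 0, forall x, p @- k @- x = 0,
        forall a, p @- a = 0 -> exists x, k @- x = a &
        forall V : pidx (pro K), exists U : pidx (pro A), forall x,
          oproj U @@ k @- x = 0 -> oproj V @@ x = 0].
Proof.
have [Z Z0] := coker_zero (und A).
pose N := pb (under p) (zmap Z (und B)); pose n : mor N (und A) := pb1 _ _.
have n0 x : n @@ x = 0 -> x = 0.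
  by move=> e; apply: pb_inj e _; apply: Z0.
have pn x : p @- n @@ x = 0 by rewrite pb_comm zmapE.
have nE a : p @- a = 0 -> exists x, n @@ x = a.
  move=> pa; have [|x [x1 _]] := @pb_elt C _ _ _ (under p) (zmap Z (und B)) a 0.
    by rewrite raddf0.
  by exists x.
have [|K [phi [psi [pK Kp c1 c2]]]] :=
  @tc_build C T N (pidx (pro A)) _ (fun U => oproj U \om n).
- split=> [|U U'|v v0|x xc].
- by exists (some_idx _).
- have [V [h h']] := dp_directed U U'; exists V => v.
  by rewrite !comp_act -(oproj_tr h) -(oproj_tr h') => ->; rewrite !raddf0.
- by apply: n0; apply: oproj_sep => U; rewrite -comp_act; apply: v0.
- have [U V h|a ha] := @oproj_complete C T A (fun U => oproj U @@ n @@ x U).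
    rewrite oproj_tr -!comp_act; apply: xc => v.
    by rewrite !comp_act -(oproj_tr h) => ->; rewrite raddf0.
  have [|v nv] := nE a.
    apply: oproj_sep => W; rewrite -oproj_nat ha oproj_nat pn raddf0.
    by [].
  by exists v => U; rewrite !comp_act nv ha.
- have [U|k hk] := @tc_lift C T K A (n \om phi).
  have [V hV] := c1 U; exists V => a /hV; by rewrite !comp_act.
exists K, k; split.
- move=> x; have /heqP-> := hk; rewrite comp_act => /n0 e.
  by rewrite -[x]pK e raddf0.
- by move=> x; have /heqP-> := hk; rewrite comp_act pn.
- move=> a /nE[v <-]; exists (psi @@ v); have /heqP-> := hk.
  by rewrite comp_act Kp.
move=> V; have [U hU] := c2 V; exists U => x; have /heqP-> := hk.
by move=> e; apply: hU; rewrite -e !comp_act.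
Qed.

(** Each condition comes from the universal property tested against one object: the
module kernel of [p] with the induced topology, the discrete module
[A/(i(A') + U)], and the discrete module [A''/(p(A) + W)]. *)
Lemma Ex1_strictly (A' A A'' : T) (i : mor A' A) (p : mor A A'') :
  Ex1 i p -> strictly_exact i p.
Proof.
move=> [kip cip]; have i_mono := kernel_mono kip.
have p_epi := cokernel_epi cip.
have pi a : p @- i @- a = 0.
  by rewrite -under_comp_act; move: a; apply/zero_mor_topP; case: kip.
split=> //.
- have [K [k [k0 pk kE kU]]] := kernel_object p.
  have [|u [iu _]] := kip.2 K k.
    by apply/zero_mor_topP => x; rewrite under_comp_act.
  have [x||w0 hw0] := fill1 (f := idmor (und K)) (h := under k) (g := under i).
  - by have [y ey] := kE _ (pi x); exists y.
  - by move=> y; rewrite act_id => /k0.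
  have kw a : k @- w0 @@ a = i @- a.
    by have [y ey] := kE _ (pi a); rewrite (hw0 a y ey) act_id.
  have [V|w hw] := @tc_lift C T A' K w0.
    have [U hU] := kU V; have [U' hU'] := continuous_at i U.
    by exists U' => a /hU' e; apply: hU; rewrite kw.
  (* Since [u] is continuous, [u w = 1] makes the topology of [A'] the one induced
     by [w], hence by [i]. *)
  have uw : u \om w =m idmor A'.
    apply: i_mono; rewrite mcompA iu mcompm1; apply/under_act => a.
    by rewrite under_comp_act; have /heqP-> := hw.
  move=> U'; have [V hV] := continuous_at u U'; have [U hU] := kU V.
  exists U => a ia.
  have wa : oproj V @@ w @- a = 0.
    by apply: hU; have /heqP-> := hw; rewrite kw.
  have := hV _ wa; rewrite -under_comp_act; move/under_act: uw => ->.
  by have /heqP-> := under_id A'; rewrite act_id.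
- move=> U; have [Q [q [qs qE]]] := coker_ex (oproj U \om under i).
  have [X [phi [psi [V [pK Kp V0]]]]] := discrete_object Q.
  have [V'|g hg] := @tc_lift C T A X (psi \om q \om oproj U).
    by exists U => a a0; rewrite !comp_act a0 !raddf0.
  have [|u [up _]] := cip.2 X g.
    apply/zero_mor_topP => a; rewrite under_comp_act; have /heqP-> := hg.
    rewrite !comp_act; suff -> : q @@ oproj U @@ i @- a = 0 by rewrite raddf0.
    by apply/qE; exists a; rewrite comp_act.
  have [W hW] := continuous_at u V; exists W => a /hW/V0.
  rewrite -under_comp_act; move/under_act: up => ->; have /heqP-> := hg.
  rewrite !comp_act => /(congr1 (act phi)); rewrite Kp raddf0 => /qE[a' <-].
  by exists a'; rewrite comp_act.
move=> W z; have [Q [q [qs qE]]] := coker_ex (oproj W \om under p).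
have [X [phi [psi [V [pK Kp V0]]]]] := discrete_object Q.
have [V'|g hg] := @tc_lift C T A'' X (psi \om q \om oproj W).
  by exists W => a a0; rewrite !comp_act a0 !raddf0.
have [o o0] := zero_map_ex A'' X.
have /under_act/(_ z) : g =m o.
  apply: p_epi; apply/under_act => a; rewrite !under_comp_act o0.
  have /heqP-> := hg; rewrite !comp_act.
  suff -> : q @@ oproj W @@ p @- a = 0 by rewrite raddf0.
  by apply/qE; exists a; rewrite comp_act.
rewrite o0; have /heqP-> := hg; rewrite !comp_act.
move=> /(congr1 (act phi)); rewrite Kp raddf0 => /qE[a <-].
by exists a; rewrite comp_act.
Qed.

Theorem exact_pro_Ex1 (A' A A'' : T) (i : mor A' A) (p : mor A A'') :
  abelian_exact (func_mor F i) (func_mor F p) <-> Ex1 i p.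
Proof.
split.
  by apply: reflect_exact;
    [apply: tc_pro_full | apply: tc_pro_faithful | apply: tc_pro_zero].
by move=> /Ex1_strictly/strictly_germwise/ge_exact.
Qed.

End TopologicalCategory.

(** * Limit-epimorphic pro-objects *)

Section LimitEpi.
Variable C : module_category.

Lemma const_germ_eq (K Z : C) (u v : germ (pro_const K) Z) :
  germ_eq u v <-> forall x, projT2 u @@ x = projT2 v @@ x.
Proof.
split=> [/germ_eqP[c [h [h' e]]] x|e].
  by have := e x; rewrite /= act_id.
by apply/germ_eqP; exists tt, I, I => x; rewrite /= act_id.
Qed.

Lemma limit_epi_const (K : C) : limit_epi (pro_const K).
Proof.
have lim : is_limit (P := pro_const K) (L := K) (fun=> idmor K).
  split=> [a b h|X x xc]; first by apply: mcomp1m.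
  exists (x tt); split=> [[]|v vx]; first exact: mcomp1m.
  by rewrite -(vx tt) mcomp1m.
exists K, (fun=> idmor K), lim => X g h gh d.
apply/const_germ_eq => x; have /const_germ_eq/(_ x) := gh d.
by rewrite /= !comp_act act_id.
Qed.

Variable T : topological_category C.

Lemma limit_epi_pro (A : T) : limit_epi (tc_pro T A : proobj C).
Proof.
have lim : is_limit (P := (tc_pro T A : proobj C)) (@oproj C T A).
  split=> [|X x xc]; first exact: oproj_cone.
  have [u hu] := cone_lift xc; exists u; split=> [U|v vx].
    by apply/heqP => t; rewrite comp_act.
  apply/heqP => t; apply: oproj_inj => U.
  by rewrite hu -comp_act; move: t; apply/heqP.
exists (und A), oproj, lim => X g h gh d.
apply: rep_val_eq (rep_self _) (rep_self _) _ => a.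
have /const_germ_eq/(_ a) := gh d.
by rewrite /= !comp_act.
Qed.

End LimitEpi.

(** * Consequences of a discrete gap in the image *)

Section Gap.
Variables (C : module_category) (T : topological_category C).
Notation F := (tc_pro T).
Notation pro A := (func_obj F A : proobj C).
Notation profun f := (func_mor F f : prohom _ _).
Notation "f @- x" := (under f @@ x) (at level 35, right associativity).

Variables (A' A A'' : T) (i : mor A' A) (p : mor A A'').
Hypothesis ip : strictly_exact i p.
Variables (K : C) (f : mor K (und A'')) (c0 : elt K).
Hypothesis c0_neq0 : c0 <> 0.
Hypothesis gap : forall c a, p @- a = f @@ c -> c = 0.

Lemma gap_cone : is_cone (P := pro A'') (fun W => oproj W \om f).
Proof. by move=> W W' h; rewrite mcompA oproj_cone. Qed.

Definition gap_pro : prohom (pro_const K) (pro A'') := cone_mor gap_cone.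

(** Otherwise the identity and the zero endomorphism of [K] would agree after
composition with the epimorphism [h]. *)
Lemma nonzero_value (L : C) (h : prohom (pro_const L) (pro_const K)) :
  epi (C := Pro C) h -> exists x, projT2 (sval h tt) @@ x <> 0.
Proof.
move=> h_epi; apply: contrapT => h0.
apply: c0_neq0.
have /(_ tt)/const_germ_eq/(_ c0) /= :
    prohom_eq (proid (pro_const K)) (zero_prohom (pro_const K) (pro_const K)).
  apply: h_epi => -[]; apply/const_germ_eq => x.
  rewrite /= !comp_act act_id zmapE.
  by apply: contrapT => hx; apply: h0; exists x.
by rewrite act_id zmapE.
Qed.

(** An element [x] of the limit of [B] with nonzero image in [K] is sent by [g] to a
compatible family in the quotients of [A], that is, to an element of [A], and
[p] takes it to a nonzero value of [f]. *)
Lemma gap_no_pro_square (B : proobj C) (g : prohom B (pro A))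
    (q : prohom B (pro_const K)) :
  limit_epi B -> epi (C := Pro C) q ->
  prohom_eq (procomp (profun p) g) (procomp gap_pro q) -> False.
Proof.
move=> [L [pi [lim pi_epi]]] q_epi sq.
set l := cone_mor (proj1 lim) in pi_epi.
have /nonzero_value[x] : epi (C := Pro C) (procomp q l).
  move=> X u v uv; apply: q_epi; apply: pi_epi.
  by rewrite -!mcompA.
apply.
pose y U := projT2 (sval (procomp g l) U) @@ x.
have [U V h|a ha] := @oproj_complete C T A y.
  have /const_germ_eq/(_ x) := svalP (procomp g l) _ _ h.
  by rewrite /y /= !comp_act.
apply: (gap (a := a)); apply: oproj_inj => W.
have e : prohom_eq (procomp (profun p) (procomp g l))
                   (procomp gap_pro (procomp q l)).
  move=> V; apply: germ_eq_trans (procompA (profun p) g l V) _.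
  apply: germ_eq_trans (procomp_eq sq (prohom_refl l) V) _.
  exact: germ_eq_sym (procompA gap_pro q l V).
have /const_germ_eq/(_ x) := e W.
by rewrite -oproj_nat ha /y /= !comp_act.
Qed.

(** The corresponding statement for topological modules, where [K'] is [K] with its
discrete topology. *)
Lemma gap_no_top_square (K' : T) (phi : mor (und K') K) (f' : mor K' A'')
    (k0 : elt (und K')) (B : T) (g : mor B A) (q : mor B K') :
  (forall k, phi @@ k = 0 -> k = 0) -> k0 <> 0 ->
  (forall k, f' @- k = f @@ phi @@ k) ->
  epi q -> p \om g =m f' \om q -> False.
Proof.
move=> phi0 k0n fE q_epi sq; apply: k0n.
have [z z0] := zero_map_ex K' K'.
have /under_act/(_ k0) : idmor K' =m z.
  apply: q_epi; rewrite mcomp1m; apply/under_act => b.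
  rewrite under_comp_act z0; apply: phi0; apply: (gap (a := g @- b)).
  by rewrite -fE -!under_comp_act; move: b; apply/under_act.
by have /heqP-> := under_id K'; rewrite act_id z0.
Qed.

Lemma gap_discrete : exists (K' : T) (phi : mor (und K') K) (f' : mor K' A'')
    (k0 : elt (und K')),
  [/\ forall k, phi @@ k = 0 -> k = 0, k0 <> 0 &
      forall k, f' @- k = f @@ phi @@ k].
Proof.
have [K' [phi [psi [V [pK Kp V0]]]]] := discrete_object T K.
have [W|f' hf'] := @tc_lift C T K' A'' (f \om phi).
  by exists V => a /V0 ->; rewrite !raddf0.
exists K', phi, f', (psi @@ c0); split.
- by move=> k e; rewrite -[k]pK e raddf0.
- by move=> /(congr1 (act phi)); rewrite Kp raddf0.
by move=> k; have /heqP-> := hf'; rewrite comp_act.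
Qed.

Theorem gap_not_Ex1_exact : ~ exact_structure (@Ex1 T).
Proof.
move=> ex; have [K' [phi [f' [k0 [phi0 k0n fE]]]]] := gap_discrete.
have [|B [q [g [[sq _] [B' [j jq]]]]]] := exact_pullback ex (p := p) f'.
  by exists A', i; apply/exact_pro_Ex1/ge_exact/strictly_germwise.
by apply: gap_no_top_square phi0 k0n fE (cokernel_epi jq.2) sq.
Qed.

Theorem gap_not_inherits_top : ~ inherits_exact F (@abelian_exact (Pro C)).
Proof.
move=> ex; have [K' [phi [f' [k0 [phi0 k0n fE]]]]] := gap_discrete.
have [|B [q [g [[sq _] [B' [j /exact_pro_Ex1 jq]]]]]] :=
    exact_pullback ex (p := p) f'.
  by exists A', i; apply/ge_exact/strictly_germwise.
by apply: gap_no_top_square phi0 k0n fE (cokernel_epi jq.2) sq.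
Qed.

Theorem gap_not_inherits_limit_epi :
  ~ inherits_exact (@incl (Pro C) (@limit_epi C)) (@abelian_exact (Pro C)).
Proof.
move=> ex.
pose le (X : T) : full_subcat (C := Pro C) (@limit_epi C) :=
  exist _ (pro X) (limit_epi_pro X).
pose Kle : full_subcat (C := Pro C) (@limit_epi C) :=
  exist _ (pro_const K) (limit_epi_const K).
pose p' : @mor (full_subcat (C := Pro C) (@limit_epi C)) (le A) (le A'') := profun p.
pose f' : @mor (full_subcat (C := Pro C) (@limit_epi C)) Kle (le A'') := gap_pro.
have [|B [q [g [[sq _] [B' [j jq]]]]]] := exact_pullback ex (p := p') f'.
  exists (le A'), (profun i : @mor (full_subcat _) (le A') (le A)).
  exact/ge_exact/strictly_germwise.
exact: gap_no_pro_square (svalP B) (cokernel_epi jq.2) sq.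
Qed.

Theorem gap_not_closed_under_extensions :
  ~ closed_under_extensions (@abelian_exact (Pro C)) (@limit_epi C).
Proof.
move=> cl; have ge := strictly_germwise ip.
have bx := pull_exact ge gap_cone.
have le := cl _ _ _ _ _ (ge_exact bx) (limit_epi_pro A') (limit_epi_const K).
apply: gap_no_pro_square le (ge_epi bx) _; last exact: pull_square.
Qed.

End Gap.

(** * Finitely supported functions and their row sums *)

(** Finitely supported functions on [N x N], encoded as polynomials in two
variables, so that row sums are values at [1].  A copy of the type is needed
because [{poly {poly k}}] is a module over [{poly k}]. *)
Definition bipoly (k : fieldType) : Type := {poly {poly k}}.
HB.instance Definition _ (k : fieldType) := GRing.Zmodule.on (bipoly k).

Section Bipoly.
Variable k : fieldType.

Definition bipoly_scale (c : k) (f : bipoly k) : bipoly k :=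
  c%:P *: (f : {poly {poly k}}).

Fact bipoly_scaleA c d f :
  bipoly_scale c (bipoly_scale d f) = bipoly_scale (c * d) f.
Proof. by rewrite /bipoly_scale scalerA polyCM. Qed.

Fact bipoly_scale1 : left_id 1 bipoly_scale.
Proof. by move=> f; rewrite /bipoly_scale scale1r. Qed.

Fact bipoly_scaleDr : right_distributive bipoly_scale +%R.
Proof. by move=> c f g; rewrite /bipoly_scale -scalerDr. Qed.

Fact bipoly_scaleDl f : {morph bipoly_scale^~ f : c d / c + d}.
Proof. by move=> c d; rewrite /bipoly_scale polyCD -scalerDl. Qed.

HB.instance Definition _ := GRing.Zmodule_isLmodule.Build k (bipoly k)
  bipoly_scaleA bipoly_scale1 bipoly_scaleDr bipoly_scaleDl.

Definition row (f : bipoly k) t : {poly k} := (f : {poly {poly k}})`_t.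

Lemma rowP c f g t : row (c *: f + g) t = c *: row f t + row g t.
Proof. by rewrite /row coefD coefZ mul_polyC. Qed.

Lemma row_poly n (E : nat -> {poly k}) t :
  row (\poly_(s < n) E s : {poly {poly k}}) t = if (t < n)%N then E t else 0.
Proof. by rewrite /row coef_poly. Qed.

Lemma row_eq f g : (forall t, row f t = row g t) -> f = g.
Proof. by move=> e; apply/polyP. Qed.

Lemma row_default f t : (size (f : {poly {poly k}}) <= t)%N -> row f t = 0.
Proof. by move=> h; rewrite /row nth_default. Qed.

(** [(m, phi)] stands for the set of all [(t, n)] with [t < m] or [n < phi t]. *)
Definition region := (nat * (nat -> nat))%type.
Definition in_region (D : region) t n := (t < D.1)%N || (n < D.2 t)%N.
Definition region_max (D E : region) : region :=
  (maxn D.1 E.1, fun t => maxn (D.2 t) (E.2 t)).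

Lemma in_region_max D E t n :
  in_region (region_max D E) t n = in_region D t n || in_region E t n.
Proof. by rewrite /in_region /= !leq_max orbACA. Qed.

Definition restr (D : region) (f : bipoly k) : nat -> nat -> k^o :=
  fun t n => if in_region D t n then (row f t)`_n else 0.

Fact restr_linear D : linear (restr D).
Proof.
move=> c f g; apply/funext => t; apply/funext => n.
change (restr D (c *: f + g) t n = c * restr D f t n + restr D g t n).
rewrite /restr; case: in_region; last by rewrite mulr0 addr0.
by rewrite rowP coefD coefZ.
Qed.
HB.instance Definition _ D := GRing.isLinear.Build k (bipoly k) _ _ (restr D)
  (restr_linear D).

Definition trunc (m : nat) (g : nat -> k^o) : nat -> k^o :=
  fun t => if (t < m)%N then g t else 0.

Fact trunc_linear m : linear (trunc m).
Proof.
move=> c f g; apply/funext => t.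
change (trunc m (c *: f + g) t = c * trunc m f t + trunc m g t).
by rewrite /trunc; case: ltnP; rewrite ?mulr0 ?addr0.
Qed.
HB.instance Definition _ m := GRing.isLinear.Build k (nat -> k^o) _ _ (trunc m)
  (trunc_linear m).

Definition row_sum (f : bipoly k) : nat -> k^o := fun t => (row f t).[1].

Fact row_sum_linear : linear row_sum.
Proof.
move=> c f g; apply/funext => t.
change (row_sum (c *: f + g) t = c * row_sum f t + row_sum g t).
by rewrite /row_sum rowP !hornerE.
Qed.
HB.instance Definition _ := GRing.isLinear.Build k (bipoly k) _ _ row_sum
  row_sum_linear.

Definition const_seq (c : k^o) : nat -> k^o := fun=> c.

Fact const_seq_linear : linear const_seq.
Proof. by []. Qed.
HB.instance Definition _ := GRing.isLinear.Build k k^o _ _ const_seq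
  const_seq_linear.

Lemma restr_eq D f g : restr D f = restr D g <->
  forall t n, in_region D t n -> (row f t)`_n = (row g t)`_n.
Proof.
split=> [e t n Dtn|e].
  by have := congr1 (fun r => r t n) e; rewrite /restr Dtn.
apply/funext => t; apply/funext => n; rewrite /restr; case: ifP => //; exact: e.
Qed.

Lemma restr0 D f : restr D f = 0 <-> forall t n, in_region D t n -> (row f t)`_n = 0.
Proof.
have -> : (0 : nat -> nat -> k^o) = restr D 0 by rewrite raddf0.
rewrite restr_eq; split=> e t n /e ->; by rewrite /row !coef0.
Qed.

Lemma trunc_eq m f g : trunc m f = trunc m g <-> forall t, (t < m)%N -> f t = g t.
Proof.
split=> [e t tm|e].
  by have := congr1 (fun r => r t) e; rewrite /trunc tm.
by apply/funext => t; rewrite /trunc; case: ifP => //; apply: e.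
Qed.

Lemma trunc0 m f : trunc m f = 0 <-> forall t, (t < m)%N -> f t = 0.
Proof.
have -> : (0 : nat -> k^o) = trunc m 0 by rewrite raddf0.
by rewrite trunc_eq.
Qed.

Lemma restrB0 D f g : restr D f = restr D g -> restr D (f - g) = 0.
Proof. by move=> e; rewrite raddfB; apply/eqP; rewrite subr_eq0; apply/eqP. Qed.

Lemma truncB0 m f g : trunc m f = trunc m g -> trunc m (f - g) = 0.
Proof. by move=> e; rewrite raddfB; apply/eqP; rewrite subr_eq0; apply/eqP. Qed.

Lemma restr_separated f : (forall D, restr D f = 0) -> f = 0.
Proof.
move=> f0; apply: row_eq => t; apply/polyP => n.
have /restr0 -> // := f0 (t.+1, fun=> 0%N).
  by rewrite /row !coef0.
by rewrite /in_region /= ltnSn.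
Qed.

(** The entries [y t] of the limit are read off at regions that contain the whole
row [t].  The region [D0] under the graph of the row lengths contains the
support of the limit, so that the limit agrees with the finitely supported
function [x D0]. *)
Lemma restr_complete (x : region -> bipoly k) :
  (forall D E, (forall f, restr E f = 0 -> restr D f = 0) ->
     restr D (x E) = restr D (x D)) ->
  exists f, forall D, restr D f = restr D (x D).
Proof.
move=> xc.
have agree D E t n : in_region D t n -> in_region E t n ->
    (row (x D) t)`_n = (row (x E) t)`_n.
  have sub D' E' : restr D' (x (region_max D' E')) = restr D' (x D').
    apply: xc => f /restr0 f0; apply/restr0 => s j h; apply: f0.
    by rewrite in_region_max h.
  have sub' : restr E (x (region_max D E)) = restr E (x E).
    apply: xc => f /restr0 f0; apply/restr0 => s j h; apply: f0.
    by rewrite in_region_max h orbT.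
  move=> Dtn Etn; have /restr_eq <- // := sub D E.
  by have /restr_eq -> := sub'.
pose y t := row (x (t.+1, fun=> 0%N)) t.
have yE D t n : in_region D t n -> (y t)`_n = (row (x D) t)`_n.
  by move=> Dtn; apply: agree => //; rewrite /in_region /= ltnSn.
pose D0 : region := (0%N, fun t => size (y t)).
pose N := size (x D0 : {poly {poly k}}).
have y0 t : (N <= t)%N -> y t = 0.
  move=> Nt; apply/polyP => n; rewrite coef0.
  have [nt|tn] := ltnP n (size (y t)); last by rewrite nth_default.
  by rewrite (yE D0) // (row_default Nt) coef0.
exists (\poly_(t < N) y t : {poly {poly k}}) => D.
apply/restr_eq => t n Dtn; rewrite row_poly -(yE D) //.
by case: ltnP => // /y0->.
Qed.

Lemma restr_filtration :
  complete_filtration (W := fun=> (nat -> nat -> k^o) : zmodType) restr.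
Proof.
split; [|move=> D D'|exact: restr_separated|exact: restr_complete].
- by exists (0%N, fun=> 0%N).
exists (region_max D D') => f /restr0 f0.
by split; apply/restr0 => t n h; apply: f0; rewrite in_region_max h ?orbT.
Qed.

Lemma trunc_filtration :
  complete_filtration (W := fun=> (nat -> k^o) : zmodType) trunc.
Proof.
split=> [|m m'|g g0|x xc].
- by exists 0%N.
- exists (maxn m m') => f /trunc0 f0.
  by split; apply/trunc0 => t h; apply: f0; rewrite leq_max h ?orbT.
- by apply/funext => t; have /trunc0-> := g0 t.+1.
exists (fun t => x t.+1 t) => m; apply/trunc_eq => t tm.
have /trunc_eq/(_ t (ltnSn t)) <- // : trunc t.+1 (x m) = trunc t.+1 (x t.+1).
apply: xc => g /trunc0 g0; apply/trunc0 => u ut; apply: g0.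
exact: leq_trans ut tm.
Qed.

Lemma row_sum_dense m (g : nat -> k^o) :
  exists f, trunc m (row_sum f) = trunc m g.
Proof.
exists (\poly_(t < m) (g t)%:P : {poly {poly k}}).
by apply/trunc_eq => t tm; rewrite /row_sum row_poly tm hornerC.
Qed.

(** The row sums are corrected at the positions [(t, phi t)]; these lie outside of
[D] except in rows whose sum is already zero. *)
Lemma row_sum_correct (D : region) f : trunc D.1 (row_sum f) = 0 ->
  exists g, row_sum g = 0 /\ restr D g = restr D f.
Proof.
move=> /trunc0 f0; pose N := size (f : {poly {poly k}}).
exists (\poly_(t < N) (row f t - (row f t).[1] *: 'X^(D.2 t)) : {poly {poly k}}).
split.
  apply/funext => t; rewrite /row_sum row_poly; case: ltnP => _.
    by rewrite !hornerE expr1n mulr1 subrr.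
  by rewrite horner0.
apply/restr_eq => t n Dtn; rewrite row_poly.
case: ltnP => [_|Nt]; last by rewrite row_default.
rewrite coefB coefZ coefXn; move: Dtn => /orP[/f0|nD].
  by rewrite /row_sum => ->; rewrite mul0r subr0.
by rewrite ltn_eqF // mulr0 subr0.
Qed.

Lemma row_sum_const f c : row_sum f = const_seq c -> c = 0.
Proof.
move/(congr1 (fun r => r (size (f : {poly {poly k}})))).
by rewrite /row_sum /const_seq row_default // horner0.
Qed.

Lemma row_sum_continuous m f :
  restr (m, fun=> 0%N) f = 0 -> trunc m (row_sum f) = 0.
Proof.
move=> /restr0 f0; apply/trunc0 => t tm.
rewrite /row_sum (_ : row f t = 0) ?horner0 //.
by apply/polyP => n; rewrite coef0 f0 // /in_region tm.
Qed.

End Bipoly.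

(** A copy of the vector spaces over [k] inside [C], which lets one construction
provide the counterexample both for vector spaces and for abelian groups. *)
Record realization (k : fieldType) (C : module_category) := Realization {
  robj : lmodType k -> C;
  rmor : forall V W : lmodType k, {linear V -> W} -> mor (robj V) (robj W);
  relt : forall V : lmodType k, {additive V -> elt (robj V)};
  relt_inj : forall V, injective (relt V);
  relt_surj : forall (V : lmodType k) x, exists v, relt V v = x;
  rmor_relt : forall (V W : lmodType k) (f : {linear V -> W}) v,
    rmor f @@ relt V v = relt W (f v)
}.

Arguments relt_inj {k C} r {V}.
Arguments relt_surj {k C} r {V} x.

Section Counterexample.
Variables (k : fieldType) (C : module_category) (E : realization k C).
Variable T : topological_category C.
Notation F := (tc_pro T).
Notation "f @- x" := (under f @@ x) (at level 35, right associativity).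

Lemma relt_eq0 (V : lmodType k) (v : V) : relt E V v = 0 <-> v = 0.
Proof.
split=> [|->]; last by rewrite raddf0.
by rewrite -(raddf0 (relt E V)); apply: relt_inj.
Qed.

Lemma rmor_eq0 (V W : lmodType k) (f : {linear V -> W}) v :
  rmor E f @@ relt E V v = 0 <-> f v = 0.
Proof. by rewrite rmor_relt; apply: relt_eq0. Qed.

Lemma realize (V : lmodType k) (J : Type) (W : J -> lmodType k)
    (r : forall j, {linear V -> W j}) :
  complete_filtration (W := W) r ->
  exists (A : T) (phi : V -> elt (und A)) (psi : mor (robj E V) (und A)),
    [/\ injective phi, forall a, exists v, phi v = a,
        forall v, psi @@ relt E V v = phi v,
        forall j, exists U : pidx (F A), forall v,
          oproj U @@ phi v = 0 -> r j v = 0 &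
        forall U : pidx (F A), exists j, forall v,
          r j v = 0 -> oproj U @@ phi v = 0].
Proof.
move=> [J0 dir sep cplt].
have [|A [phi [psi [pK Kp c1 c2]]]] :=
  @tc_build C T (robj E V) J (fun j => robj E (W j)) (fun j => rmor E (r j)).
  split=> [|j j'|y|x xc].
- exact: J0.
- have [l hl] := dir j j'; exists l => y.
  by have [v <-] := relt_surj E y; rewrite !rmor_eq0; apply: hl.
- have [v <-] := relt_surj E y => v0.
  by apply/relt_eq0/sep => j; apply/rmor_eq0/v0.
- have ex j := cid (relt_surj E (x j)); pose y j := sval (ex j).
  have xy j : relt E V (y j) = x j by apply: svalP (ex j).
  have [j l h|v hv] := cplt y.
    apply: (relt_inj E); rewrite -!rmor_relt !xy; apply: xc => z.
    by have [v <-] := relt_surj E z; rewrite !rmor_eq0; apply: h.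
  by exists (relt E V v) => j; rewrite rmor_relt hv -rmor_relt xy.
exists A, (fun v => psi @@ relt E V v), psi; split=> //.
- by move=> u v /(congr1 (act phi)); rewrite !Kp; apply: relt_inj.
- move=> a; have [v ev] := relt_surj E (phi @@ a); exists v.
  by rewrite ev pK.
- move=> j; have [U hU] := c1 j; exists U => v /hU.
  by rewrite Kp rmor_eq0.
move=> U; have [j hj] := c2 U; exists j => v rv; apply: hj.
by rewrite Kp rmor_eq0.
Qed.

Theorem gap_sequence_ex : exists (A' A A'' : T) (i : mor A' A) (p : mor A A'')
    (K : C) (f : mor K (und A'')) (c0 : elt K),
  [/\ strictly_exact i p, c0 <> 0 & forall c a, p @- a = f @@ c -> c = 0].
Proof.
have [A [phi [s [phi_inj phi_surj sE c1 c2]]]] :=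
  realize (W := fun=> (nat -> nat -> k^o) : lmodType k) (r := @restr k)
    (restr_filtration k).
have [A'' [phi'' [s'' [phi''_inj phi''_surj sE'' c1'' c2'']]]] :=
  realize (W := fun=> (nat -> k^o) : lmodType k) (r := @trunc k)
    (trunc_filtration k).
have phiD u v : phi (u - v) = phi u - phi v by rewrite -!sE !raddfB.
have phi''D u v : phi'' (u - v) = phi'' u - phi'' v by rewrite -!sE'' !raddfB.
have [x||p0 hp0] := fill1
    (f := s'' \om rmor E (@row_sum k : {linear bipoly k -> (nat -> k^o)}))
    (h := s) (g := idmor (und A)).
- have [v <-] := phi_surj x; exists (relt E _ v).
  by rewrite sE act_id.
- move=> y; have [v <-] := relt_surj E y; rewrite sE => pv.
  have -> : v = 0 by apply: phi_inj; rewrite pv -sE !raddf0.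
  by rewrite !raddf0.
have p0E v : p0 @@ phi v = phi'' (row_sum v).
  rewrite (hp0 _ (relt E _ v)) ?sE ?act_id //.
  by rewrite comp_act rmor_relt sE''.
have [W|p hp] := @tc_lift C T A A'' p0.
  have [m hm] := c2'' W; have [U hU] := c1 (m, fun=> 0%N); exists U => a.
  have [v <-] := phi_surj a; rewrite p0E => /hU v0; apply: hm.
  exact: row_sum_continuous.
have pE v : p @- phi v = phi'' (row_sum v) by have /heqP-> := hp.
have phi''0 : phi'' 0 = 0 by rewrite -sE'' !raddf0.
have [A' [i [i0 pi iE iU]]] := kernel_object p.
exists A', A, A'', i, p, (robj E k^o),
  (s'' \om rmor E (@const_seq k : {linear k^o -> (nat -> k^o)})),
  (relt E k^o 1); split.
- split=> //.
    move=> U; have [D hD] := c2 U; have [W hW] := c1'' D.1.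
    exists W => a; have [v <-] := phi_surj a.
    rewrite pE => /hW/row_sum_correct[w [w0 wv]].
    have [|x ex] := iE (phi w); first by rewrite pE w0.
    exists x; rewrite ex; apply/eqP; rewrite -subr_eq0 -raddfB -phiD; apply/eqP.
    exact: hD (restrB0 wv).
  move=> W a''; have [g <-] := phi''_surj a''; have [m hm] := c2'' W.
  have [v hv] := row_sum_dense m g; exists (phi v); rewrite pE.
  apply/eqP; rewrite -subr_eq0 -raddfB -phi''D; apply/eqP.
  exact: hm (truncB0 hv).
- by move/relt_eq0/eqP; rewrite oner_eq0.
move=> c a; have [x <-] := relt_surj E c; have [v <-] := phi_surj a.
rewrite pE comp_act rmor_relt sE'' => /phi''_inj/row_sum_const ->.
exact: raddf0.
Qed.

Theorem pro_le_not_exact :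
  [/\ ~ inherits_exact (@incl (Pro C) (@limit_epi C)) (@abelian_exact (Pro C)),
      ~ inherits_exact F (@abelian_exact (Pro C)),
      (forall (A' A A'' : T) (i : mor A' A) (p : mor A A''),
         abelian_exact (func_mor F i) (func_mor F p) <-> Ex1 i p),
      ~ exact_structure (@Ex1 T) &
      ~ closed_under_extensions (@abelian_exact (Pro C)) (@limit_epi C)].
Proof.
have [A' [A [A'' [i [p [K [f [c0 [ip c0n gap]]]]]]]]] := gap_sequence_ex.
split.
- exact: (gap_not_inherits_limit_epi ip c0n gap).
- exact: (gap_not_inherits_top ip c0n gap).
- exact: exact_pro_Ex1.
- exact: (gap_not_Ex1_exact ip c0n gap).
- exact: (gap_not_closed_under_extensions ip c0n gap).
Qed.

End Counterexample.

(** * Abelian groups *)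

Section FillFunction.
Variables (X Y Z : zmodType) (J : Type) (W : J -> zmodType).
Variables (f : {additive Y -> Z}) (h : forall j, {additive Y -> W j}).
Variable (g : forall j, {additive X -> W j}).
Hypothesis fillable : forall x, exists y, forall j, h j y = g j x.
Hypothesis ker_le : forall y, (forall j, h j y = 0) -> f y = 0.

Lemma fill_function : exists u : X -> Z,
  forall x y, (forall j, h j y = g j x) -> u x = f y.
Proof.
exists (fun x => f (sval (cid (fillable x)))) => x y e.
apply/eqP; rewrite -subr_eq0 -raddfB; apply/eqP; apply: ker_le => j.
by rewrite raddfB e (svalP (cid (fillable x))) subrr.
Qed.

End FillFunction.

Section AbFill.
Variables (X Y Z : Ab) (J : Type) (W : J -> Ab).
Variables (f : mor Y Z) (h : forall j, mor Y (W j)) (g : forall j, mor X (W j)).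

Lemma Ab_fill :
  (forall x, exists y, forall j, h j y = g j x) ->
  (forall y, (forall j, h j y = 0) -> f y = 0) ->
  exists u : mor X Z, forall x y, (forall j, h j y = g j x) -> u x = f y.
Proof.
move=> ex k0; have [u hu] := fill_function ex k0.
have u_zmod : zmod_morphism u.
  move=> x x'; have [y ey] := ex x; have [y' ey'] := ex x'.
  rewrite (hu x y ey) (hu x' y' ey') -raddfB; apply: hu => j.
  by rewrite !raddfB ey ey'.
pose U : {additive X -> Z} :=
  HB.pack u (GRing.isZmodMorphism.Build _ _ u u_zmod).
by exists U.
Qed.

End AbFill.

Section AbCoker.
Variables (A B : zmodType) (f : {additive A -> B}).

Definition image_pred : {pred B} := [pred b | `[< exists a, f a = b >]].

Lemma image_zmod_closed : zmod_closed image_pred.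
Proof.
split; first by apply/asboolP; exists 0; rewrite raddf0.
move=> _ _ /asboolP[a <-] /asboolP[b <-]; apply/asboolP.
by exists (a - b); rewrite raddfB.
Qed.
HB.instance Definition _ :=
  GRing.isZmodClosed.Build B image_pred image_zmod_closed.

Lemma quot_pi_eq0 (U : zmodClosed B) b : quot_pi U b = 0 <-> b \in U.
Proof. by rewrite -(raddf0 (quot_pi U)) quot_pi_eq subr0. Qed.

Lemma Ab_coker : exists (Q : Ab) (q : mor (B : Ab) Q),
  (forall z, exists b, q b = z) /\ forall b, q b = 0 <-> exists a, f a = b.
Proof.
exists ({quot image_pred} : zmodType), (quot_pi image_pred : {additive _ -> _}).
split=> [z|b]; first by exists (repr z); apply: quot_pi_repr.
by rewrite quot_pi_eq0; split=> /asboolP.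
Qed.

End AbCoker.

Section AbPullback.
Variables (A B W : zmodType) (f : {additive A -> W}) (g : {additive B -> W}).

Definition fib_pred : {pred A * B} := [pred x | f x.1 == g x.2].

Lemma fib_zmod_closed : zmod_closed fib_pred.
Proof.
split=> [|x y]; rewrite !inE /= ?raddf0 // => /eqP ex /eqP ey.
by rewrite !raddfB ex ey.
Qed.
HB.instance Definition _ :=
  GRing.isZmodClosed.Build (A * B)%type fib_pred fib_zmod_closed.

Record fib := Fib { fib_val : A * B; fib_valP : fib_val \in fib_pred }.
HB.instance Definition _ := [isSub for fib_val].
HB.instance Definition _ := [Choice of fib by <:].
HB.instance Definition _ := [SubChoice_isSubZmodule of fib by <:].

Definition fib1 (x : fib) : A := (fib_val x).1.
Definition fib2 (x : fib) : B := (fib_val x).2.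

Fact fib1_zmod_morphism : zmod_morphism fib1. Proof. by []. Qed.
Fact fib2_zmod_morphism : zmod_morphism fib2. Proof. by []. Qed.
HB.instance Definition _ :=
  GRing.isZmodMorphism.Build fib A fib1 fib1_zmod_morphism.
HB.instance Definition _ :=
  GRing.isZmodMorphism.Build fib B fib2 fib2_zmod_morphism.

Lemma fib_comm x : f (fib1 x) = g (fib2 x).
Proof. exact/eqP/(fib_valP x). Qed.

Lemma fib_inj0 x : fib1 x = 0 -> fib2 x = 0 -> x = 0.
Proof.
move=> x1 x2; apply: val_inj => /=.
by rewrite [LHS]surjective_pairing [(fib_val x).1]x1 [(fib_val x).2]x2.
Qed.

Lemma fib_elt a b : f a = g b -> exists x, fib1 x = a /\ fib2 x = b.
Proof. by move=> /eqP e; exists (@Fib (a, b) e). Qed.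

End AbPullback.

Definition Ab_module_category : module_category :=
  @ModuleCategory Ab (fun A => A) (fun A B f => f) (fun A B f g => iff_refl _)
    (fun A x => erefl) (fun X Y Z g f x => erefl)
    (fun A B => \0 : {additive A -> B}) (fun A B x => erefl)
    Ab_fill Ab_coker
    (fun A B W f g => fib f g)
    (fun A B W f g => @fib1 A B W f g : {additive fib f g -> A})
    (fun A B W f g => @fib2 A B W f g : {additive fib f g -> B})
    fib_comm fib_inj0 fib_elt.

Definition Ab_realization (k : fieldType) : realization k Ab_module_category :=
  @Realization k Ab_module_category (fun V => V : zmodType)
    (fun V W f => f : {additive V -> W}) (fun V => idfun)
    (fun V => @inj_id V) (fun V x => ex_intro _ x erefl) (fun V W f v => erefl).

(** * The topology defined by a complete filtration *)

(** A copy of [V] that carries the topology; the filtration is a dummy argument from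
which the instances find the neighbourhoods. *)
Definition kernel_space (V : zmodType) (J : Type) (W : J -> zmodType)
  (r : forall j, {additive V -> W j}) & complete_filtration r : Type := V.

Section KernelTopology.
Variables (V : zmodType) (J : Type) (W : J -> zmodType).
Variable r : forall j, {additive V -> W j}.
Hypothesis filt : complete_filtration r.

Local Notation S := (kernel_space filt).
HB.instance Definition _ := GRing.Zmodule.on S.

Definition kernel_nbhs (x : S) : set_system S :=
  [set N | exists j, forall y : S, r j (y - x) = 0 -> N y].

Lemma kernel_nbhs_filter x : ProperFilter (kernel_nbhs x).
Proof.
split=> [[j hj]|]; first by apply: (hj x); rewrite subrr raddf0.
split=> [|P Q [j hj] [j' hj']|P Q PQ [j hj]].
- by have [j _] := filt_nonempty filt; exists j.
- have [l hl] := filt_directed filt j j'; exists l => y /hl[yj yj'].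
  by split; [apply: hj | apply: hj'].
by exists j => y /hj/PQ.
Qed.

Lemma kernel_nbhs_singleton x (A : set S) : kernel_nbhs x A -> A x.
Proof. by move=> [j]; apply; rewrite subrr raddf0. Qed.

Lemma kernel_nbhs_nbhs x (A : set S) :
  kernel_nbhs x A -> kernel_nbhs x (kernel_nbhs^~ A).
Proof.
move=> [j hj]; exists j => y yx; exists j => z zy; apply: hj.
by rewrite -(subrK y z) -addrA raddfD zy add0r.
Qed.

HB.instance Definition _ := hasNbhs.Build S kernel_nbhs.
HB.instance Definition _ := Nbhs_isNbhsTopological.Build S
  kernel_nbhs_filter kernel_nbhs_singleton kernel_nbhs_nbhs.

Lemma kernel_sub_continuous : continuous (fun x : S * S => x.1 - x.2).
Proof.
move=> [a b] N [j hj] /=.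
exists ([set y | r j (y - a) = 0], [set y | r j (y - b) = 0]).
  by split; exists j.
move=> [y z] [/= ya zb]; apply: hj.
have -> : y - z - (a - b) = (y - a) - (z - b).
  by rewrite !opprB addrACA [RHS]addrACA [X in _ = _ + X]addrC.
by rewrite raddfB ya zb subrr.
Qed.

HB.instance Definition _ :=
  PreTopologicalNmodule_isTopologicalZmodule.Build S kernel_sub_continuous.

Lemma kernel_open_zmod (U : zmodClosed S) j :
  (forall x, r j x = 0 -> x \in U) -> open [set x | x \in U].
Proof.
move=> jU; rewrite openE => x xU; exists j => y /jU yx.
by rewrite /= -(subrK x y) rpredD.
Qed.

Lemma open_contains_kernel (A : set S) :
  open A -> A 0 -> exists j, forall v, r j v = 0 -> A v.
Proof.
rewrite openE => oA /oA [j hj]; exists j => v rv; apply: hj.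
by rewrite subr0.
Qed.

End KernelTopology.

Lemma addr_continuous (M : topologicalZmodType) (c : M) :
  continuous (fun y : M => y + c).
Proof.
move=> x; apply: (@continuous_comp _ _ _ (fun y => (y, c))
  (fun z : M * M => z.1 + z.2)); last exact: add_continuous.
by apply: cvg_pair; [exact: cvg_id | exact: cvg_cst].
Qed.

Lemma additive_continuous (A B : topologicalZmodType) (f : {additive A -> B}) :
  (forall N, nbhs (0 : B) N -> nbhs (0 : A) (f @^-1` N)) -> continuous f.
Proof.
move=> f0 x N Nfx.
have /f0 : nbhs (0 : B) ((fun y => y + f x) @^-1` N).
  by apply: addr_continuous; rewrite add0r.
move=> N0.
have : nbhs x ((fun y => y - x) @^-1` (f @^-1` ((fun y => y + f x) @^-1` N))).
  by apply: addr_continuous; rewrite subrr.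
apply: filterS => y /=.
by rewrite raddfB subrK.
Qed.

(** * Topological abelian groups *)

Section AbKernelTopology.
Variables (V : zmodType) (J : Type) (W : J -> zmodType).
Variable r : forall j, {additive V -> W j}.
Hypothesis filt : complete_filtration r.
Local Notation S := (kernel_space filt).

Definition kernel_pred j : {pred S} := [pred x | r j x == 0].

Lemma kernel_zmod_closed j : zmod_closed (kernel_pred j).
Proof.
split=> [|x y]; rewrite !inE ?raddf0 // => /eqP x0 /eqP y0.
by rewrite raddfB x0 y0 subrr.
Qed.
HB.instance Definition _ j :=
  GRing.isZmodClosed.Build S (kernel_pred j) (kernel_zmod_closed j).

Lemma kernel_pred_open j : open [set x | x \in kernel_pred j].
Proof. by apply: (@kernel_open_zmod _ _ _ _ _ _ j) => x /eqP. Qed.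

Definition kernel_subgroup j : open_subgroup S :=
  OpenSubgroup (@kernel_pred_open j).

Lemma subgroup_contains_kernel (U : open_subgroup S) :
  exists j, forall v, r j v = 0 -> v \in U.
Proof. exact: open_contains_kernel (os_open U) (rpred0 U). Qed.

Lemma kernel_linear_topology : linear_topology S.
Proof.
move=> N [j hj]; exists (kernel_subgroup j) => x /eqP x0.
by apply: hj; rewrite subr0.
Qed.

Lemma kernel_separated : is_separated S.
Proof.
move=> a b /(congr1 sval) e; apply/eqP; rewrite -subr_eq0.
apply/eqP/(filt_separated filt) => j.
have /quot_pi_eq/eqP := congr1 (fun x => x (kernel_subgroup j)) e.
exact.
Qed.

Lemma kernel_complete : is_complete S.
Proof.
move=> [x xc]; pose y j : S := repr (x (kernel_subgroup j)).
have yE j : quot_pi (kernel_subgroup j) (y j) = x (kernel_subgroup j).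
  exact: quot_pi_repr.
have yU j (U : open_subgroup S) : (forall v, r j v = 0 -> v \in U) ->
    quot_pi U (y j) = x U.
  move=> jU; have h : os_le U (kernel_subgroup j) by move=> v /eqP/jU.
  by rewrite -(xc _ _ h) -yE os_trE.
have [j l h|v hv] := filt_complete filt (x := y).
  have /quot_pi_eq/eqP : quot_pi (kernel_subgroup j) (y l) =
      quot_pi (kernel_subgroup j) (y j).
    by rewrite yE; apply: yU => v /h/eqP.
  by rewrite raddfB => /eqP; rewrite subr_eq0 => /eqP.
exists v; apply: eq_exist; apply: functional_extensionality_dep => U.
have [j hj] := subgroup_contains_kernel U.
rewrite -(yU j U hj); apply/quot_pi_eq/hj.
by rewrite raddfB hv subrr.
Qed.

Definition kernel_topsc : topsc_group :=
  TopscGroup kernel_linear_topology kernel_separated kernel_complete.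

End AbKernelTopology.

Lemma TopscZ_build (V : Ab_module_category) (J : Type)
    (W : J -> Ab_module_category) (r : forall j, mor V (W j)) :
  complete_filtration (fun j => act (r j)) ->
  exists (A : TopscZ) (phi : @mor Ab (A : zmodType) V)
    (psi : @mor Ab V (A : zmodType)),
    [/\ forall a, psi (phi a) = a, forall v, phi (psi v) = v,
        forall j, exists U : open_subgroup A, forall a,
          quot_pi U a = 0 -> r j (phi a) = 0 &
        forall U : open_subgroup A, exists j, forall a,
          r j (phi a) = 0 -> quot_pi U a = 0].
Proof.
move=> filt.
exists (@kernel_topsc V J W r filt), (idfun : {additive V -> V}),
  (idfun : {additive V -> V}); split=> //.
- move=> j; exists (kernel_subgroup filt j) => a.
  by move=> /quot_pi_eq0/eqP.
- move=> U; have [j hj] := subgroup_contains_kernel U.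
  by exists j => a a0; apply/quot_pi_eq0/hj.
Qed.

Lemma TopscZ_lift (A B : TopscZ) (g : @mor Ab (A : zmodType) (B : zmodType)) :
  (forall V : open_subgroup B, exists U : open_subgroup A,
     forall a, quot_pi U a = 0 -> quot_pi V (g a) = 0) ->
  exists f : mor A B, @heq Ab _ _ (ca_map f) g.
Proof.
move=> h; have gc : continuous (g : {additive A -> B}).
  apply: additive_continuous => N /tg_linear[V VN].
  have [U hU] := h V; have U0 : nbhs (0 : A) [set x | x \in U].
    by apply: open_nbhs_nbhs; split; [exact: os_open | exact: rpred0].
  by apply: filterS U0 => a aU; apply: VN; apply/quot_pi_eq0/hU/quot_pi_eq0.
by exists (ContAdditive gc).
Qed.

Lemma TopscZ_complete (A : TopscZ) (x : forall U : open_subgroup A, {quot U}) :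
  os_compatible x ->
  exists a : A, forall U : open_subgroup A, quot_pi U a = x U.
Proof.
move=> xc; have [a ea] := tg_complete (exist _ x xc).
by exists a => U; have /(congr1 (fun y => sval y U)) := ea.
Qed.

Lemma TopscZ_sep (A : TopscZ) (a : A) :
  (forall U : open_subgroup A, quot_pi U a = 0) -> a = 0.
Proof.
move=> a0; apply: (@tg_separated A); apply: eq_exist.
by apply: functional_extensionality_dep => U; rewrite a0 raddf0.
Qed.

Lemma quot_pi_surj (A : zmodType) (U : zmodClosed A) (z : {quot U}) :
  exists a, quot_pi U a = z.
Proof. by exists (repr z); apply: quot_pi_repr. Qed.

Definition TopscZ_category : topological_category Ab_module_category :=
  @TopologicalCategory Ab_module_category TopscZ TopscZ_Pro
    (fun A => (A : zmodType)) (fun A B f => ca_map f)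
    (fun A B f g => iff_refl _) (fun A x => erefl) (fun X Y Z g f x => erefl)
    (fun A U => quot_pi (U : open_subgroup A) : {additive A -> _})
    (fun A U V h x => @os_trE A U V h x)
    (fun A U z => quot_pi_surj z)
    TopscZ_sep TopscZ_complete
    (fun A B f V a => os_preim_mapE f V a)
    TopscZ_lift TopscZ_build.

(** * Vector spaces *)

Section VectFill.
Variable k : fieldType.
Variables (X Y Z : Vect k) (J : Type) (W : J -> Vect k).
Variables (f : mor Y Z) (h : forall j, mor Y (W j)) (g : forall j, mor X (W j)).

Lemma Vect_fill :
  (forall x, exists y, forall j, h j y = g j x) ->
  (forall y, (forall j, h j y = 0) -> f y = 0) ->
  exists u : mor X Z, forall x y, (forall j, h j y = g j x) -> u x = f y.
Proof.
move=> ex k0.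
have [u hu] := @fill_function X Y Z J (fun j => W j) f
  (fun j => h j) (fun j => g j) ex k0.
have u_lin : linear u.
  move=> c x x'; have [y ey] := ex x; have [y' ey'] := ex x'.
  rewrite (hu x y ey) (hu x' y' ey') -linearP; apply: hu => j.
  by rewrite /= !linearP ey ey'.
pose U : {linear X -> Z} := HB.pack u (GRing.isLinear.Build _ _ _ _ u u_lin).
by exists U.
Qed.

End VectFill.

Section VectCoker.
Variables (k : fieldType) (A B : lmodType k) (f : {linear A -> B}).

Definition vimage_pred : {pred B} := [pred b | `[< exists a, f a = b >]].

Lemma vimage_submod_closed : submod_closed vimage_pred.
Proof.
split; first by apply/asboolP; exists 0; rewrite linear0.
move=> c _ _ /asboolP[a <-] /asboolP[b <-]; apply/asboolP.
by exists (c *: a + b); rewrite linearP.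
Qed.
HB.instance Definition _ :=
  GRing.isSubmodClosed.Build k B vimage_pred vimage_submod_closed.

Lemma vquot_pi_eq0 (U : submodClosed B) b : vquot_pi U b = 0 <-> b \in U.
Proof. by rewrite -(linear0 (vquot_pi U)) vquot_pi_eq subr0. Qed.

Lemma vquot_pi_surj (U : submodClosed B) (z : vquot U) : exists b, vquot_pi U b = z.
Proof. by exists (repr (z : {quot submod_pred U})); apply: vquot_pi_repr. Qed.

Lemma Vect_coker : exists (Q : Vect k) (q : mor (B : Vect k) Q),
  (forall z, exists b, q b = z) /\ forall b, q b = 0 <-> exists a, f a = b.
Proof.
exists (vquot vimage_pred : lmodType k), (vquot_pi vimage_pred : {linear _ -> _}).
split=> [z|b]; first exact: vquot_pi_surj.
by rewrite vquot_pi_eq0; split=> /asboolP.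
Qed.

End VectCoker.

Section VectPullback.
Variable k : fieldType.
Variables (A B W : lmodType k) (f : {linear A -> W}) (g : {linear B -> W}).

Definition vfib_pred : {pred A * B} := [pred x | f x.1 == g x.2].

Lemma vfib_submod_closed : submod_closed vfib_pred.
Proof.
split=> [|c x y]; rewrite !inE /= ?linear0 // => /eqP ex /eqP ey.
by rewrite !linearP ex ey.
Qed.
HB.instance Definition _ :=
  GRing.isSubmodClosed.Build k (A * B)%type vfib_pred vfib_submod_closed.

Record vfib := VFib { vfib_val : A * B; vfib_valP : vfib_val \in vfib_pred }.
HB.instance Definition _ := [isSub for vfib_val].
HB.instance Definition _ := [Choice of vfib by <:].
HB.instance Definition _ := [SubChoice_isSubLmodule of vfib by <:].

Definition vfib1 (x : vfib) : A := (vfib_val x).1.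
Definition vfib2 (x : vfib) : B := (vfib_val x).2.

Fact vfib1_linear : linear vfib1. Proof. by []. Qed.
Fact vfib2_linear : linear vfib2. Proof. by []. Qed.
HB.instance Definition _ :=
  GRing.isLinear.Build k vfib A _ vfib1 vfib1_linear.
HB.instance Definition _ :=
  GRing.isLinear.Build k vfib B _ vfib2 vfib2_linear.

Lemma vfib_comm x : f (vfib1 x) = g (vfib2 x).
Proof. exact/eqP/(vfib_valP x). Qed.

Lemma vfib_inj0 x : vfib1 x = 0 -> vfib2 x = 0 -> x = 0.
Proof.
move=> x1 x2; apply: val_inj => /=.
by rewrite [LHS]surjective_pairing [(vfib_val x).1]x1 [(vfib_val x).2]x2.
Qed.

Lemma vfib_elt a b : f a = g b -> exists x, vfib1 x = a /\ vfib2 x = b.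
Proof. by move=> /eqP e; exists (@VFib (a, b) e). Qed.

End VectPullback.

Definition Vect_module_category (k : fieldType) : module_category :=
  @ModuleCategory (Vect k) (fun A => A) (fun A B f => f : {additive _ -> _})
    (fun A B f g => iff_refl _)
    (fun A x => erefl) (fun X Y Z g f x => erefl)
    (fun A B => \0 : {linear A -> B}) (fun A B x => erefl)
    (@Vect_fill k) (@Vect_coker k)
    (fun A B W f g => vfib f g)
    (fun A B W f g => @vfib1 k A B W f g : {linear vfib f g -> A})
    (fun A B W f g => @vfib2 k A B W f g : {linear vfib f g -> B})
    (@vfib_comm k) (@vfib_inj0 k) (@vfib_elt k).

Definition Vect_realization (k : fieldType) :
  realization k (Vect_module_category k) :=
  @Realization k (Vect_module_category k) (fun V => V)
    (fun V W f => f) (fun V => idfun)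
    (fun V => @inj_id V) (fun V x => ex_intro _ x erefl) (fun V W f v => erefl).

(** * Topological vector spaces *)

Section VectKernelTopology.
Variables (k : fieldType) (V : lmodType k) (J : Type) (W : J -> lmodType k).
Variable r : forall j, {linear V -> W j}.
Hypothesis filt : complete_filtration r.
Local Notation S := (kernel_space filt).

Definition kernel_lmod : topLmod k :=
  @TopLmod k S (GRing.Zmodule_isLmodule.Build k S
    (@scalerA k V) (@scale1r k V) (@scalerDr k V)
    (fun v a b => @scalerDl k V v a b)).

Definition vkernel_pred j : {pred kernel_lmod} := [pred x | r j x == 0].

Lemma vkernel_submod_closed j : submod_closed (vkernel_pred j).
Proof.
split=> [|c x y]; first by rewrite inE linear0.
rewrite !inE => /eqP x0 /eqP y0.
by rewrite [r j _](linearP (r j) c x y) x0 y0 scaler0 addr0.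
Qed.
HB.instance Definition _ j :=
  GRing.isSubmodClosed.Build k kernel_lmod (vkernel_pred j)
    (vkernel_submod_closed j).

Lemma vkernel_pred_open j : open [set x | x \in vkernel_pred j].
Proof. exact: (@kernel_pred_open V J (fun j => W j) (fun j => r j) filt j). Qed.

Definition kernel_subspace j : open_subspace kernel_lmod :=
  OpenSubspace (@vkernel_pred_open j).

Lemma subspace_contains_kernel (U : open_subspace kernel_lmod) :
  exists j, forall v, r j v = 0 -> v \in U.
Proof.
exact: (@open_contains_kernel V J (fun j => W j) (fun j => r j) filt _
  (ov_open U) (rpred0 U)).
Qed.

Lemma kernel_vlinear_topology : vlinear_topology kernel_lmod.
Proof.
move=> N [j hj]; exists (kernel_subspace j) => x /eqP x0.
by apply: hj; rewrite subr0.
Qed.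

Lemma kernel_vseparated : is_vseparated kernel_lmod.
Proof.
move=> a b /(congr1 sval) e; apply/eqP; rewrite -subr_eq0.
apply/eqP/(filt_separated filt) => j.
have /vquot_pi_eq/eqP := congr1 (fun x => x (kernel_subspace j)) e.
exact.
Qed.

Lemma kernel_vcomplete : is_vcomplete kernel_lmod.
Proof.
move=> [x xc].
pose y j : kernel_lmod :=
  repr (x (kernel_subspace j) : {quot submod_pred (kernel_subspace j)}).
have yE j : vquot_pi (kernel_subspace j) (y j) = x (kernel_subspace j).
  exact: vquot_pi_repr.
have yU j (U : open_subspace kernel_lmod) : (forall v, r j v = 0 -> v \in U) ->
    vquot_pi U (y j) = x U.
  move=> jU; have h : ov_le U (kernel_subspace j) by move=> v /eqP/jU.
  by rewrite -(xc _ _ h) -yE ov_trE.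
have [j l h|v hv] := filt_complete filt (x := y).
  have /vquot_pi_eq/eqP : vquot_pi (kernel_subspace j) (y l) =
      vquot_pi (kernel_subspace j) (y j).
    by rewrite yE; apply: yU => v /h/eqP.
  by rewrite [r j _](raddfB (r j) (y l) (y j)) => /eqP; rewrite subr_eq0 => /eqP.
exists v; apply: eq_exist; apply: functional_extensionality_dep => U.
have [j hj] := subspace_contains_kernel U.
rewrite -(yU j U hj); apply/vquot_pi_eq/hj.
apply: (etrans (raddfB (r j) v (y j))); apply/eqP.
by rewrite subr_eq0; apply/eqP; apply: hv.
Qed.

Definition kernel_topsc_space : topsc_space k :=
  TopscSpace kernel_vlinear_topology kernel_vseparated kernel_vcomplete.

End VectKernelTopology.

Section TopscVectInstance.
Variable k : fieldType.
Implicit Types A B : TopscVect k.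

Lemma TopscVect_build (V : Vect_module_category k) (J : Type)
    (W : J -> Vect_module_category k) (r : forall j, mor V (W j)) :
  complete_filtration (fun j => act (r j)) ->
  exists (A : TopscVect k) (phi : @mor (Vect k) (A : lmodType k) V)
    (psi : @mor (Vect k) V (A : lmodType k)),
    [/\ forall a, psi (phi a) = a, forall v, phi (psi v) = v,
        forall j, exists U : open_subspace A, forall a,
          vquot_pi U a = 0 -> r j (phi a) = 0 &
        forall U : open_subspace A, exists j, forall a,
          r j (phi a) = 0 -> vquot_pi U a = 0].
Proof.
move=> filt; pose A := @kernel_topsc_space k V J W r filt.
have lin1 : linear (fun a : A => a : V) by [].
have lin2 : linear (fun v : V => v : A) by [].
pose phi : {linear A -> V} := HB.pack (fun a : A => a : V)
  (GRing.isLinear.Build _ _ _ _ _ lin1).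
pose psi : {linear V -> A} := HB.pack (fun v : V => v : A)
  (GRing.isLinear.Build _ _ _ _ _ lin2).
exists A, phi, psi; split=> //.
- move=> j; exists (kernel_subspace filt j) => a.
  by move=> /vquot_pi_eq0/eqP.
- move=> U; have [j hj] := subspace_contains_kernel U.
  by exists j => a a0; apply/vquot_pi_eq0/hj.
Qed.

Lemma TopscVect_lift A B (g : @mor (Vect k) (A : lmodType k) (B : lmodType k)) :
  (forall V : open_subspace B, exists U : open_subspace A,
     forall a, vquot_pi U a = 0 -> vquot_pi V (g a) = 0) ->
  exists f : mor A B, @heq (Vect k) _ _ (cl_map f) g.
Proof.
move=> h; have gc : continuous (g : {linear A -> B}).
  apply: (@additive_continuous A B (g : {linear A -> B})) => N /ts_linear[V VN].
  have [U hU] := h V; have U0 : nbhs (0 : A) [set x | x \in U].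
    by apply: open_nbhs_nbhs; split; [exact: ov_open | exact: rpred0].
  by apply: filterS U0 => a aU; apply: VN; apply/vquot_pi_eq0/hU/vquot_pi_eq0.
by exists (ContLinear gc).
Qed.

Lemma TopscVect_complete A (x : forall U : open_subspace A, vquot U) :
  ov_compatible x ->
  exists a : A, forall U : open_subspace A, vquot_pi U a = x U.
Proof.
move=> xc; have [a ea] := ts_complete (exist _ x xc).
by exists a => U; have /(congr1 (fun y => sval y U)) := ea.
Qed.

Lemma TopscVect_sep A (a : A) :
  (forall U : open_subspace A, vquot_pi U a = 0) -> a = 0.
Proof.
move=> a0; apply: (@ts_separated k A); apply: eq_exist.
by apply: functional_extensionality_dep => U; rewrite a0 linear0.
Qed.

Definition TopscVect_category : topological_category (Vect_module_category k) :=
  @TopologicalCategory (Vect_module_category k) (TopscVect k) (TopscVect_Pro k)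
    (fun A => (A : lmodType k)) (fun A B f => cl_map f)
    (fun A B f g => iff_refl _) (fun A x => erefl) (fun X Y Z g f x => erefl)
    (fun A U => vquot_pi (U : open_subspace A) : {linear A -> _})
    (fun A U V h x => @ov_trE k A U V h x)
    (fun A U z => vquot_pi_surj z)
    TopscVect_sep TopscVect_complete
    (fun A B f V a => ov_preim_mapE f V a)
    TopscVect_lift TopscVect_build.

End TopscVectInstance.

Theorem proposition9p5 (k : fieldType) :
  ([/\ ~ inherits_exact (@incl (Pro Ab) (@limit_epi Ab))
           (@abelian_exact (Pro Ab)),
       ~ inherits_exact TopscZ_Pro (@abelian_exact (Pro Ab)),
       (forall (A' A A'' : TopscZ) (i : mor A' A) (p : mor A A''),
          abelian_exact (func_mor TopscZ_Pro i) (func_mor TopscZ_Pro p) <-> Ex1 i p),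
       ~ exact_structure (@Ex1 TopscZ) &
       ~ closed_under_extensions (@abelian_exact (Pro Ab)) (@limit_epi Ab)])
  /\
  ([/\ ~ inherits_exact (@incl (Pro (Vect k)) (@limit_epi (Vect k)))
           (@abelian_exact (Pro (Vect k))),
       ~ inherits_exact (TopscVect_Pro k) (@abelian_exact (Pro (Vect k))),
       (forall (A' A A'' : TopscVect k) (i : mor A' A) (p : mor A A''),
          abelian_exact (func_mor (TopscVect_Pro k) i) (func_mor (TopscVect_Pro k) p)
            <-> Ex1 i p),
       ~ exact_structure (@Ex1 (TopscVect k)) &
       ~ closed_under_extensions (@abelian_exact (Pro (Vect k)))
           (@limit_epi (Vect k))]).
Proof.
split.
- exact: pro_le_not_exact (Ab_realization k) TopscZ_category.
- exact: pro_le_not_exact (Vect_realization k) (TopscVect_category k).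
Qed.
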